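(* Let $d\ge 1$, let $\mathbf x,\mathbf m\in\mathbb C^d$ with $\mathbf x\neq 0$, $\operatorname{supp}(\widehat{\mathbf x})\subseteq[\gamma]_0$ and $\operatorname{supp}(\mathbf m)\subseteq[\delta]_0$, where $\gamma\le 2\delta-1<d$. Put $L=2\gamma-1$ and $K=2\delta-1$ and assume that $K$ and $L$ both divide $d$. Assume $$\mu_2:=\min_{|p|\le\gamma-1,\ |q|\le\delta-1}\left|\left(F_d(\widehat{\mathbf m}\circ S_p\overline{\widehat{\mathbf m}})\right)_q\right|>0,$$ and that the noise satisfies $\|N_{K,L}\|_F\le\beta\|\mathbf x\|_2^2$ for some $\beta\ge0$. Define the estimate $\mathbf x_e$ as follows. Let $\widetilde Y=F_LY_{K,L}^TF_K^T$. For integers $\omega,\alpha$ with $|\omega|\le\delta-1$ and $|\alpha|\le\gamma-1$, set $\alpha'=-\alpha$ if $\alpha\le 0$ and $\alpha'=L-\alpha$ if $\alpha\ge1$; set $\omega'=\omega$ if $\omega\ge0$ and $\omega'=\omega+K$ if $\omega<0$; and define the $(2\delta-1)\times(2\gamma-1)$ matrix $V$ (rows indexed by $\omega\in\{1-\delta,\dots,\delta-1\}$, columns by $\alpha\in\{1-\gamma,\dots,\gamma-1\}$) by $$V_{\omega,\alpha}=\frac{d^3}{KL}\,\frac{\widetilde Y_{\alpha',\omega'}}{\left(F_d(\widehat{\mathbf m}\circ S_{-\alpha}\overline{\widehat{\mathbf m}})\right)_\omega}.$$ Let $W\in\mathbb C^{(2\delta-1)\times\gamma}$ have entries $W_{\omega,n}=e^{-2\pi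 i\omega n/d}$ for $\omega\in\{1-\delta,\dots,\delta-1\}$, $n\in[\gamma]_0$ (equivalently $W_{j,k}=e^{-2\pi i(j-\delta+1)k/d}$, $j\in[2\delta-1]_0$, $k\in[\gamma]_0$), let $W^\dagger=(W^*W)^{-1}W^*$, and let $B=W^\dagger V\in\mathbb C^{\gamma\times(2\gamma-1)}$ (rows indexed by $[\gamma]_0$, columns by $\{1-\gamma,\dots,\gamma-1\}$). Let $G_0\in\mathbb C^{\gamma\times\gamma}$ be given by $(G_0)_{j,k}=B_{j,k-j}$ for $j,k\in[\gamma]_0$, and $G=\tfrac12(G_0+G_0^* )$. Let $\lambda_1$ be the largest eigenvalue of $G$ and $\mathbf v_1$ an associated unit-norm eigenvector. Define $\widehat{\mathbf x}_e\in\mathbb C^d$ by $(\widehat{\mathbf x}_e)_j=\sqrt{|\lambda_1|}(\mathbf v_1)_j$ for $j\in[\gamma]_0$ and $(\widehat{\mathbf x}_e)_j=0$ otherwise, and $\mathbf x_e=F_d^{-1}\widehat{\mathbf x}_e$. Then $$\min_{\phi\in[0,2\pi]}\frac{\|\mathbf x-e^{i\phi}\mathbf x_e\|_2}{\|\mathbf x\|_2}\le\frac{(1+2\sqrt2)\,\beta}{\sigma_\gamma(W)}\cdot\frac{d^2}{\sqrt{KL}\,\mu_2},$$ where $\sigma_\gamma(W)$ is the $\gamma$-th (smallest) singular value of $W$.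
   Context: Vectors in $\mathbb C^d$ are indexed by $[d]_0=\{0,1,\dots,d-1\}$, with all indices interpreted modulo $d$. $F_n$ denotes the $n\times n$ DFT matrix $(F_n)_{j,k}=e^{-2\pi i jk/n}$, and $\widehat{\mathbf x}=F_d\mathbf x$, i.e. $\widehat x_k=\sum_{n=0}^{d-1}x_ne^{-2\pi i nk/d}$. The shift is $(S_\ell\mathbf x)_n=x_{n+\ell}$; $\circ$ is the entrywise product and $\overline{\mathbf x}$ the entrywise conjugate. Measurements: given $\mathbf x,\mathbf m\in\mathbb C^d$ and an arbitrary real noise matrix $N\in\mathbb R^{d\times d}$, $Y\in\mathbb R^{d\times d}$ has entries $Y_{k,\ell}=\left|\sum_{n=0}^{d-1}x_nm_{n-\ell}e^{-2\pi i nk/d}\right|^2+N_{k,\ell}$ for $k,\ell\in[d]_0$. For positive integers $K,L$ dividing $d$, $Y_{K,L}$ is the $K\times L$ matrix $(Y_{K,L})_{k,\ell}=Y_{kd/K,\ell d/L}$ and $N_{K,L}$ is defined analogously from $N$. The matrix $\widetilde Y=F_LY_{K,L}^TF_K^T$ is $L\times K$ with rows indexed by $[L]_0$ and columns by $[K]_0$. *)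

(* Defs.v *)
(* The complex field is modelled by an arbitrary
   C : numClosedFieldType. *)
From HB Require Import structures.
From mathcomp Require Import all_boot all_order all_algebra.
Unset Printing Implicit Defensive.
Import Order.TTheory GRing.Theory Num.Theory.
Local Open Scope ring_scope.

Section Defs.
Context {C : numClosedFieldType}.

(* e^{-2 pi i / n}: the n-th root of -1 of minimal argument is e^{i pi/n};
   conjugate and square it. *)
Definition zeta (n : nat) : C := ((n.-root (-1))^*) ^+ 2.

(* the n x n DFT matrix (F_n)_{j,k} = e^{-2 pi i jk/n} *)
Definition dftmx (n : nat) : 'M[C]_n := \matrix_(j < n, k < n) zeta n ^+ (j * k).

(* entry (i,j) of a matrix addressed by natural numbers (0 outside range) *)
Definition mxnat {m n} (A : 'M[C]_(m, n)) (i j : nat) : C :=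
  match @insub _ (fun k => k < m)%N _ i, @insub _ (fun k => k < n)%N _ j with
  | Some i', Some j' => A i' j'
  | _, _ => 0
  end.

(* x_k for k an integer interpreted modulo d *)
Definition vat {d} (x : 'cV[C]_d) (k : int) : C := mxnat x (absz (k %% d)%Z) 0.

(* shift (S_l x)_n = x_{n+l} *)
Definition shiftv {d} (l : int) (x : 'cV[C]_d) : 'cV[C]_d :=
  \col_(n < d) vat x (n%:Z + l).

Definition conjv {d} (x : 'cV[C]_d) : 'cV[C]_d := map_mx Num.conj x.

Definition hadamard {d} (x y : 'cV[C]_d) : 'cV[C]_d := \col_(n < d) (x n 0 * y n 0).

(* conjugate transpose *)
Definition ctr {m n} (A : 'M[C]_(m, n)) : 'M[C]_(n, m) := (map_mx Num.conj A)^T.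

(* Euclidean norm *)
Definition vnorm {d} (x : 'cV[C]_d) : C := sqrtC (\sum_(i < d) `|x i 0| ^+ 2).

(* measurements Y_{k,l} = |sum_n x_n m_{n-l} e^{-2 pi i nk/d}|^2 + N_{k,l} *)
Definition Ymeas {d} (x m : 'cV[C]_d) (N : 'M[C]_d) (k l : nat) : C :=
  `| \sum_(n < d) vat x n * vat m (n%:Z - l%:Z) * zeta d ^+ (n * k) | ^+ 2
  + mxnat N k l.

(* Y_{K,L} *)
Definition Ysub {d} K L (x m : 'cV[C]_d) (N : 'M[C]_d) : 'M[C]_(K, L) :=
  \matrix_(k < K, l < L) Ymeas x m N (k * (d %/ K)) (l * (d %/ L)).

(* N_{K,L} *)
Definition Nsub {d} K L (N : 'M[C]_d) : 'M[C]_(K, L) :=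
  \matrix_(k < K, l < L) mxnat N (k * (d %/ K)) (l * (d %/ L)).

Definition frob {m n} (A : 'M[C]_(m, n)) : C :=
  sqrtC (\sum_(i < m) \sum_(j < n) `|A i j| ^+ 2).

(* Ytilde = F_L Y_{K,L}^T F_K^T *)
Definition Ytilde {d} K L (x m : 'cV[C]_d) (N : 'M[C]_d) : 'M[C]_(L, K) :=
  dftmx L *m (Ysub K L x m N)^T *m (dftmx K)^T.

(* (F_d (mhat o S_p conj(mhat)))_q *)
Definition gmask {d} (m : 'cV[C]_d) (p q : int) : C :=
  let mh := dftmx d *m m in
  vat (dftmx d *m hadamard mh (shiftv p (conjv mh))) q.

(* alpha' and omega' *)
Definition alphap (L : nat) (a : int) : nat :=
  if (a <= 0)%R then absz (- a) else absz (L%:Z - a).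
Definition omegap (K : nat) (w : int) : nat :=
  if (0 <= w)%R then absz w else absz (w + K%:Z).

(* V : rows omega = j - (delta-1), columns alpha = a - (gamma-1) *)
Definition Vmx {d} gamma delta K L (x m : 'cV[C]_d) (N : 'M[C]_d) : 'M[C]_(K, L) :=
  \matrix_(j < K, a < L)
    let w := j%:Z - (delta.-1)%:Z in
    let al := a%:Z - (gamma.-1)%:Z in
    ((d ^ 3)%:R / (K * L)%:R) *
      (mxnat (Ytilde K L x m N) (alphap L al) (omegap K w) / gmask m (- al) w).

(* W_{omega,n} = e^{-2 pi i omega n / d} *)
Definition Wmx d gamma delta K : 'M[C]_(K, gamma) :=
  \matrix_(j < K, k < gamma) zeta d ^ ((j%:Z - (delta.-1)%:Z) * k%:Z).

Definition pinv {m n} (A : 'M[C]_(m, n)) : 'M[C]_(n, m) :=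
  invmx (ctr A *m A) *m ctr A.

(* B = W^dagger V, G0_{j,k} = B_{j,k-j}, G = (G0 + G0^* )/2 *)
Definition Gmx {d} gamma delta K L (x m : 'cV[C]_d) (N : 'M[C]_d) : 'M[C]_gamma :=
  let B := pinv (Wmx d gamma delta K) *m Vmx gamma delta K L x m N in
  let G0 := \matrix_(j < gamma, k < gamma) mxnat B j (k + gamma.-1 - j)%N in
  2%:R^-1 *: (G0 + ctr G0).

(* xhat_e from lambda_1, v_1 *)
Definition xhat_e d gamma (lam : C) (v : 'cV[C]_gamma) : 'cV[C]_d :=
  \col_(j < d) (if (j < gamma)%N then sqrtC `|lam| * mxnat v j 0 else 0).

(* s is the gamma-th (smallest) singular value of W : 'M_(K,gamma), K >= gamma *)
Definition smallest_sv {m n} (A : 'M[C]_(m, n)) (s : C) : Prop :=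
  0 <= s /\ eigenvalue (ctr A *m A) (s ^+ 2) /\
  forall mu, eigenvalue (ctr A *m A) mu -> s ^+ 2 <= mu.

(* lam is the largest eigenvalue of G, v an associated unit eigenvector *)
Definition top_eigpair {n} (G : 'M[C]_n) (lam : C) (v : 'cV[C]_n) : Prop :=
  G *m v = lam *: v /\ vnorm v = 1 /\
  forall mu, eigenvalue G mu -> mu <= lam.

(* mu2 = min_{|p|<=gamma-1, |q|<=delta-1} |(F_d(mhat o S_p conj mhat))_q| *)
Definition is_mu2 {d} gamma delta (m : 'cV[C]_d) (mu : C) : Prop :=
  (forall p q : int, (absz p <= gamma.-1)%N -> (absz q <= delta.-1)%N ->
     mu <= `|gmask m p q|) /\
  (exists p q : int, [/\ (absz p <= gamma.-1)%N, (absz q <= delta.-1)%N &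
     mu = `|gmask m p q|]).

End Defs.

(* Main.v *)
(* The DFTs over the K x L sampling grid alias the full autocorrelation of the
   measurements modulo K and modulo L, but the supports of m and of xhat have
   length at most delta and gamma, so with K = 2 delta - 1 and L = 2 gamma - 1
   exactly one representative of each residue survives.  Hence in the
   noise-free case V = W B0, where B0 lists the diagonals of the rank-one matrix
   u u^*, u being xhat restricted to [gamma]_0.  The noise reaches G through the
   scaled isometries F_L and F_K, the division by the mask term (at least mu2 in
   modulus) and W^dagger (operator norm 1/s), which bounds the Frobenius
   distance of G to u u^* by some eta.  Finally, for v the top eigenvector of G,
   E = G - u u^* and c = <v, u>, the components of E v along and orthogonal to v
   give (lam - |c|^2)^2 + |c|^2 (|u|^2 - |c|^2) <= eta^2, which together with
   lam >= |u|^2 - eta yields |u - z sqrt|lam| v| <= sqrt 14 eta / |u|, and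
   14 <= (1 + 2 sqrt 2)^2. *)
Require Import Defs.
From HB Require Import structures.
From mathcomp Require Import all_boot all_order all_algebra.
From mathcomp Require Import separable cyclotomic spectral sesquilinear zify ring.
Import Order.TTheory GRing.Theory Num.Theory.
Local Open Scope ring_scope.

Set Implicit Arguments.
Unset Strict Implicit.

(** * The root of -1 of minimal argument *)

Section UnitCircle.
Variable C : numClosedFieldType.
Implicit Types y e z w : C.

Lemma Re_mul_conj y e : 'Re (y * e^*) = 'Re y * 'Re e + 'Im y * 'Im e.
Proof. by rewrite ReM Re_conj Im_conj mulrN opprK. Qed.

Lemma Im_mul_conj y e : 'Im (y * e^*) = 'Im y * 'Re e - 'Re y * 'Im e.
Proof. by rewrite ImM Re_conj Im_conj mulrN addrC mulrC. Qed.

Lemma Im_sqr_unit z : `|z| = 1 -> 'Im z ^+ 2 = 1 - 'Re z ^+ 2.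
Proof. by move=> z1; rewrite -[1 in RHS](expr1n _ 2) -z1 normC2_Re_Im addrC addKr. Qed.

Lemma Re_unit_lt1 z : `|z| = 1 -> z != 1 -> 'Re z < 1.
Proof.
move=> z1 zn1; rewrite lt_neqAle -{2}z1 leif_Re_Creal andbT.
apply: contraNneq zn1 => R1; apply/eqP.
apply: eqC_semipolar; rewrite ?z1 ?normr1 ?R1 //.
  by rewrite (Creal_ReP _ _) // rpred1.
by rewrite (Creal_ImP 1 _) ?mulr0 // rpred1.
Qed.

Lemma ler_Im_unit y e : `|y| = 1 -> `|e| = 1 -> 0 <= 'Im e -> 0 <= 'Im y ->
  0 <= 'Re y -> 'Re y <= 'Re e -> 'Im e <= 'Im y.
Proof.
move=> y1 e1 Ie Iy Ry le; rewrite -(@ler_pXn2r _ 2) ?nnegrE //.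
rewrite !Im_sqr_unit // lerD2l lerN2 ler_pXn2r ?nnegrE //; exact: le_trans le.
Qed.

(* With angles 0 < arg e <= arg y <= pi, rotating y back by arg e moves it
   towards 1 and keeps it in the upper half plane. *)
Lemma Re_rotate_back y e : `|y| = 1 -> `|e| = 1 -> 0 <= 'Im y -> 0 <= 'Im e ->
  e != 1 -> 'Re y <= 'Re e -> 'Re y < 'Re (y * e^*).
Proof.
move=> y1 e1 Iy Ie en1 le; rewrite Re_mul_conj.
have lt1 := Re_unit_lt1 e1 en1.
have p1 : 0 < 1 - 'Re e by rewrite subr_gt0.
suff h : 'Re y * (1 - 'Re e) < 'Im y * 'Im e 
  by rewrite -ltrBlDl -[X in X - _ < _]mulr1 -mulrBr.
have [Ry|Ry] := real_leP (rpred0 _) (Creal_Re y); last first.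
  by apply: (@lt_le_trans _ _ 0); rewrite ?mulr_ge0 // nmulr_rlt0.
have le2 : 'Im e * 'Im e <= 'Im y * 'Im e by rewrite ler_wpM2r // ler_Im_unit.
apply: lt_le_trans le2; rewrite -expr2 Im_sqr_unit //.
have -> : 1 - 'Re e ^+ 2 = (1 + 'Re e) * (1 - 'Re e) by ring.
rewrite ltr_pM2r //; apply: le_lt_trans le _; by rewrite ltrDr ltr01.
Qed.

(** The angle arg y - arg e stays in [0, pi]. The split on the signs of the real parts is what lets
    their comparison pass through squares to the imaginary parts, or conversely. *)
Lemma Im_rotate_back y e : `|y| = 1 -> `|e| = 1 -> 0 <= 'Im y -> 0 <= 'Im e ->
  'Re y <= 'Re e -> 0 <= 'Im (y * e^*).
Proof.
move=> y1 e1 Iy Ie le; rewrite Im_mul_conj subr_ge0.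
have [Re0|Re0] := real_leP (rpred0 _) (Creal_Re e).
  have [Ry|Ry] := real_leP (rpred0 _) (Creal_Re y).
    by rewrite mulrC; apply: ler_pM; rewrite // ler_Im_unit.
  by apply: (@le_trans _ _ 0); rewrite ?mulr_ge0 // mulr_le0_ge0 // ltW.
have Ry : 'Re y < 0 by apply: le_lt_trans Re0.
rewrite -lerN2 -mulrN -mulNr [leRHS]mulrC; apply: ler_pM;
  rewrite ?oppr_ge0 ?lerN2 ?(ltW Re0) //.
rewrite -(@ler_pXn2r _ 2) ?nnegrE // !Im_sqr_unit // lerD2l lerN2.
by rewrite -[leLHS]sqrrN -[leRHS]sqrrN ler_pXn2r ?nnegrE ?oppr_ge0 ?lerN2 ?(ltW Ry) ?(ltW Re0).
Qed.

Lemma norm_unity_root n z : (0 < n)%N -> z ^+ n = 1 -> `|z| = 1.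
Proof.
move=> n0 zn; apply/eqP; rewrite -(@eqrXn2 _ n) ?normr_ge0 ?ler01 //.
by rewrite -normrX zn normr1 expr1n.
Qed.

Lemma conjC_unit z : `|z| = 1 -> z^* = z^-1.
Proof. by move=> z1; rewrite invC_norm z1 expr1n invr1 mul1r. Qed.

Section Root.
Variable n : nat.
Hypothesis n0 : (0 < n)%N.
Let w : C := n.-root (-1).

Lemma rootN1_expn : w ^+ n = -1. Proof. exact: rootCK. Qed.

Lemma rootN1_exp2n : w ^+ (2 * n) = 1.
Proof. by rewrite mulnC exprM rootN1_expn sqrrN expr1n. Qed.

Lemma rootN1_norm : `|w| = 1.
Proof. by apply: (@norm_unity_root (2 * n)); rewrite ?muln_gt0 // rootN1_exp2n. Qed.

Lemma rootN1_Im_ge0 : 0 <= 'Im w.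
Proof.
have [n1|] := ltnP 1 n; first exact: Im_rootC_ge0.
rewrite leq_eqVlt ltnNge n0 orbF /w => /eqP ->.
by rewrite root1C raddfN /= (Creal_ImP 1 _) ?oppr0 ?rpred1.
Qed.

Lemma rootN1_neq1 : w != 1.
Proof.
by apply: contra_eq_neq rootN1_expn => ->; rewrite expr1n -addr_eq0 -mulr2n pnatr_eq0.
Qed.

(** By definition [w] is extremal only among the n-th roots of -1 in the upper half plane. An n-th
    root z of 1 there, other than 1 and with larger real part, would rotate [w] back to an n-th root
    of -1 nearer to 1, a contradiction. *)
Lemma rootN1_Re_max z : z ^+ (2 * n) = 1 -> z != 1 -> 'Re z <= 'Re w.
Proof.
move=> z2n zn1.
have z1 : `|z| = 1 by apply: norm_unity_root z2n; rewrite muln_gt0.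
wlog Iz : z z2n zn1 z1 / 0 <= 'Im z.
  move=> IH; have [/IH->//|/ltW Iz] := real_leP (rpred0 _) (Creal_Im z).
  rewrite -Re_conj; apply: IH; rewrite ?norm_conjC ?Im_conj ?oppr_ge0 //.
    by rewrite -rmorphXn z2n rmorph1.
  by apply: contraNneq zn1 => zc; rewrite -[z]conjCK zc rmorph1.
have : (z ^+ n) ^+ 2 == 1 by rewrite -exprM mulnC z2n.
rewrite sqrf_eq1 => /orP[]/eqP zn; last exact: rootC_Re_max.
rewrite real_leNgt ?Creal_Re //; apply/negP => lt.
have zc : (w * z^*) ^+ n = -1.
  by rewrite exprMn rootN1_expn -rmorphXn zn rmorph1 mulr1.
have := @rootC_Re_max C n (-1) (w * z^*) n0 zc.
move/(_ (Im_rotate_back rootN1_norm z1 rootN1_Im_ge0 Iz (ltW lt))).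
apply/negP; rewrite -real_ltNge ?Creal_Re //.
exact: Re_rotate_back rootN1_norm z1 rootN1_Im_ge0 Iz zn1 (ltW lt).
Qed.

(* Otherwise the element of the coset z <w> nearest to 1 could be moved
   nearer still. *)
Lemma rootN1_gen z : z ^+ (2 * n) = 1 -> exists k, z = w ^+ k.
Proof.
have nn0 : (0 < 2 * n)%N by rewrite muln_gt0.
suff gen u : u ^+ (2 * n) = 1 ->
    (forall k, 'Re (u * w ^+ k) <= 'Re u) -> u = 1.
  move=> z2n; pose f (i : 'I_(2 * n)) := 'Re (z * w ^+ i).
  have [i0 _ max] := real_arg_maxP (P := predT) (i0 := Ordinal nn0) isT
    (fun i _ => Creal_Re (z * w ^+ i) : f i \is Num.real).
  have modE k : w ^+ k = w ^+ (k %% (2 * n)).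
    by rewrite {1}(divn_eq k (2 * n)) exprD mulnC exprM rootN1_exp2n expr1n mul1r.
  have : z * w ^+ i0 = 1.
    apply: gen => [|k].
      by rewrite exprMn z2n mul1r -exprM mulnC exprM rootN1_exp2n expr1n.
    rewrite -mulrA -exprD modE.
    exact: (max (Ordinal (ltn_pmod (i0 + k) nn0)) isT).
  move=> E; exists (2 * n - i0)%N.
  have := rootN1_exp2n; rewrite -{1}(subnKC (ltnW (ltn_ord i0))) exprD => F.
  apply: (mulIf (x := w ^+ i0)); last by rewrite E [RHS]mulrC F.
  by apply/eqP => w0; move: E; rewrite w0 mulr0 => /esym/eqP; rewrite oner_eq0.
move=> u2n max; apply/eqP/negPn/negP => un1.
have u1 : `|u| = 1 by apply: norm_unity_root u2n.
have leu := rootN1_Re_max u2n un1.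
have wconj : w^* = w ^+ (2 * n).-1.
  rewrite conjC_unit ?rootN1_norm //; apply: (mulfI (x := w)).
    by rewrite -normr_eq0 rootN1_norm oner_eq0.
  by rewrite divff -?exprS ?prednK ?rootN1_exp2n // -normr_eq0 rootN1_norm oner_eq0.
have [Iu|/ltW Iu] := real_leP (rpred0 _) (Creal_Im u).
  have := Re_rotate_back u1 rootN1_norm Iu rootN1_Im_ge0 rootN1_neq1 leu.
  by apply/negP; rewrite -real_leNgt ?Creal_Re // wconj.
have uc1 : `|u^*| = 1 by rewrite norm_conjC.
have Iuc : 0 <= 'Im u^* by rewrite Im_conj oppr_ge0.
rewrite -Re_conj in leu.
have := Re_rotate_back uc1 rootN1_norm Iuc rootN1_Im_ge0 rootN1_neq1 leu.
rewrite -rmorphM !Re_conj /=.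
by apply/negP; rewrite -real_leNgt ?Creal_Re // -[w]expr1.
Qed.

(** By [rootN1_gen] every root of X^(2n) - 1 is a power of [w]. This polynomial has 2n distinct
    roots, and [w] has only as many powers as its order m, so 2n <= m. *)
Lemma rootN1_prim : (2 * n).-primitive_root w.
Proof.
have nn0 : (0 < 2 * n)%N by rewrite muln_gt0.
have [m mprim mdvd] := prim_order_exists nn0 rootN1_exp2n.
suff le : (2 * n <= m)%N.
  have <- // : m = (2 * n)%N.
  by apply/eqP; rewrite eqn_leq le andbT dvdn_leq.
pose p : {poly C} := 'X^(2 * n) - 1.
have [r Dr] := closed_field_poly_normal p.
have monp : lead_coef p = 1 by apply/eqP; exact: (monicXnsubC 1 nn0).
rewrite monp scale1r in Dr.
have szr : size r = (2 * n)%N.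
  by apply: succn_inj; rewrite -(size_prod_XsubC r id) -Dr size_XnsubC.
have ur : uniq r.
  rewrite -separable_prod_XsubC -Dr.
  by apply: separable_Xn_sub_1; rewrite pnatr_eq0 -lt0n.
rewrite -szr; have /uniq_leq_size : {subset r <= [seq w ^+ i | i <- iota 0 m]} => [z|].
  rewrite -root_prod_XsubC -Dr rootE !hornerE subr_eq0 => /eqP zn.
  have [k ->] := rootN1_gen zn.
  by rewrite -(prim_expr_mod mprim); apply: map_f;
    rewrite mem_iota ltn_pmod // (prim_order_gt0 mprim).
by move/(_ ur); rewrite size_map size_iota.
Qed.

Lemma rootN1_mulC : w * w^* = 1.
Proof. by rewrite -normCK rootN1_norm expr1n. Qed.

Lemma rootN1_expn_norm k : `|w ^+ k| = 1.
Proof. by rewrite normrX rootN1_norm expr1n. Qed.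

Lemma rootN1_expX2n k : (w ^+ k) ^+ (2 * n) = 1.
Proof. by rewrite -exprM mulnC exprM rootN1_exp2n expr1n. Qed.

(** Induction through the reflection z |-> - z^* in the imaginary axis, which preserves the
    imaginary part: rotating the reflection of w^k back by [w] gives the reflection of w^(k+1). It
    may be rotated because w^k differs from -1 for k < n. *)
Lemma rootN1_exp_Im_ge0 k : (k <= n)%N -> 0 <= 'Im (w ^+ k).
Proof.
elim: k => [|k IH] kn; first by rewrite expr0 (Creal_ImP 1 _) // rpred1.
have Iz := IH (ltnW kn); set z := w ^+ k in Iz.
have tn1 : - z^* != 1.
  apply/eqP => /(canRL opprK) /(canRL conjCK); rewrite rmorphN1 -rootN1_expn.
  move/eqP; rewrite (eq_prim_root_expr rootN1_prim) !modn_small; lia.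
have t2n : (- z^*) ^+ (2 * n) = 1.
  by rewrite exprNn -rmorphXn rootN1_expX2n rmorph1 mulr1 exprM sqrrN expr1n expr1n.
have t1 : `|- z^*| = 1 by rewrite normrN norm_conjC rootN1_expn_norm.
have It : 0 <= 'Im (- z^*) by rewrite raddfN /= Im_conj opprK.
have := Im_rotate_back t1 rootN1_norm It rootN1_Im_ge0 (rootN1_Re_max t2n tn1).
by rewrite mulNr -rmorphM raddfN /= Im_conj opprK exprSr.
Qed.

Lemma rootN1_exp_Re_decr j k : (j <= k <= n)%N -> 'Re (w ^+ k) <= 'Re (w ^+ j).
Proof.
elim: k => [|k IH] /andP[jk kn]; first by move: jk; rewrite leqn0 => /eqP ->.
move: jk; rewrite leq_eqVlt => /predU1P[-> //|jk].
apply: le_trans (IH _); last by rewrite -ltnS jk ltnW.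
have wn1 : w ^+ k.+1 != 1.
  rewrite -(expr0 w) (eq_prim_root_expr rootN1_prim) !modn_small; lia.
have := Re_rotate_back (rootN1_expn_norm k.+1) rootN1_norm (rootN1_exp_Im_ge0 kn)
  rootN1_Im_ge0 rootN1_neq1 (rootN1_Re_max (rootN1_expX2n _) wn1).
by rewrite exprSr -mulrA rootN1_mulC mulr1 => /ltW.
Qed.
End Root.

(* Both sides are the element of largest real part among the nontrivial
   (2 a)-th roots of unity, since Re (w ^+ k) decreases for k <= n. *)
Lemma rootN1_exp_mul a b : (0 < a)%N -> (0 < b)%N ->
  (a * b).-root (-1) ^+ b = a.-root (-1) :> C.
Proof.
move=> a0 b0; have ab0 : (0 < a * b)%N by rewrite muln_gt0 a0.
have bab : (b <= a * b)%N by rewrite leq_pmull.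
set w := (a * b).-root (-1); set u := a.-root (-1).
have Ib : 0 <= 'Im (w ^+ b) by exact: rootN1_exp_Im_ge0.
have wu : 'Re (w ^+ b) <= 'Re u.
  by apply: rootC_Re_max; rewrite // -exprM mulnC rootN1_expn.
(* Both [w ^+ b] and [u] are of modulus 1 in the closed upper half plane, so equal real parts make
   them equal. One inequality is [wu]; the other is read off from any expression of [u] as a power
   of [w]. *)
have wn1 k : 'Re (w ^+ k) <= 'Re (w ^+ b) -> w ^+ k = u -> w ^+ b = u.
  move=> le E; apply: eqC_semipolar.
  - by rewrite rootN1_expn_norm // rootN1_norm.
  - by apply/le_anti; rewrite wu -E.
  - by rewrite mulr_ge0 // rootN1_Im_ge0.
have u2n : u ^+ (2 * (a * b)) = 1 by rewrite mulnA exprM rootN1_exp2n // expr1n.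
have [k0 uk0] := rootN1_gen ab0 u2n.
have prim := rootN1_prim ab0.
have {uk0} uk : u = w ^+ (k0 %% (2 * (a * b))) by rewrite (prim_expr_mod prim).
have : (k0 %% (2 * (a * b)) < 2 * (a * b))%N by rewrite ltn_pmod // muln_gt0.
move: uk; move: (k0 %% _)%N => k uk klt.
apply: (wn1 k) => //.
(* Since [u] is a 2a-th root of unity, its exponent is a multiple of b, hence at least b. *)
have bk : (b %| k)%N.
  have : u ^+ (2 * a) == 1 by rewrite rootN1_exp2n.
  by rewrite uk -exprM -(prim_order_dvd prim) mulnA (mulnC k) dvdn_pmul2l // muln_gt0.
have k0' : (0 < k)%N.
  by rewrite lt0n; apply: contra_neqN (rootN1_neq1 a0) => /eqP k0E; rewrite -/u uk k0E.
have [kab|kab] := leqP k (a * b).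
  by apply: rootN1_exp_Re_decr; rewrite // kab andbT dvdn_leq.
(* Past the half turn, conjugation replaces k by 2ab - k, again a positive multiple of b. *)
have -> : 'Re (w ^+ k) = 'Re (w ^+ (2 * (a * b) - k)).
  rewrite -Re_conj; congr ('Re _); rewrite rmorphXn /= conjC_unit ?rootN1_norm //.
  have w0 : w \is a GRing.unit by rewrite unitfE -normr_eq0 rootN1_norm // oner_eq0.
  by rewrite exprVn exprB ?(ltnW klt) // rootN1_exp2n // mul1r.
apply: rootN1_exp_Re_decr => //; apply/andP; split; last lia.
by rewrite dvdn_leq ?subn_gt0 // dvdn_sub // mulnA dvdn_mull.
Qed.

(** [zeta n] is the inverse of the square of the root of -1, that is, its (n-1)-th power, and n - 1
    is coprime to n. *)
Lemma zeta_prim n : (0 < n)%N -> n.-primitive_root (zeta n : C).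
Proof.
move=> n0; rewrite /zeta conjC_unit ?rootN1_norm // exprVn.
have := dvdn_prim_root (rootN1_prim n0) (dvdn_mull 2 (dvdnn n)).
rewrite mulnK // => prim.
have : n.-primitive_root ((n.-root (-1 : C) ^+ 2) ^+ n.-1).
  by rewrite (prim_root_exp_coprime n.-1 prim) coprimePn.
congr (_.-primitive_root _).
apply: (mulfI (x := n.-root (-1) ^+ 2)).
  by rewrite expf_eq0 -normr_eq0 rootN1_norm // oner_eq0.
rewrite -exprS prednK // (prim_expr_order prim) divff //.
by rewrite expf_eq0 -normr_eq0 rootN1_norm // oner_eq0.
Qed.

(** This links the small transforms F_K and F_L to F_d. As the roots are chosen by minimal argument,
    separately for each order, their compatibility rests on [rootN1_exp_mul]. *)
Lemma zeta_exp_div d n : (0 < d)%N -> (n %| d)%N -> zeta d ^+ (d %/ n) = zeta n :> C.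
Proof.
move=> d0 nd; have n0 := dvdn_gt0 d0 nd.
rewrite /zeta -exprM mulnC exprM -rmorphXn.
rewrite -[in X in X.-root](divnK nd) (mulnC _ n) rootN1_exp_mul //.
by rewrite divn_gt0 // dvdn_leq.
Qed.

Lemma zeta_norm n : (0 < n)%N -> `|zeta n : C| = 1.
Proof. by move=> n0; rewrite /zeta normrX norm_conjC rootN1_norm // expr1n. Qed.

End UnitCircle.

(** * The discrete Fourier transform *)

Section Periodic.
Variables (C : numClosedFieldType) (d : nat).
Hypothesis d0 : (0 < d)%N.
Implicit Types (f : int -> C) (x m : 'cV[C]_d) (a b c k l : int).

Lemma modord_subproof k : (absz (k %% d%:Z)%Z < d)%N.
Proof.
have := ltz_pmod k (d := d%:Z); have := modz_ge0 k (d := d%:Z); lia.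
Qed.

Definition modord k : 'I_d := Ordinal (modord_subproof k).

Lemma modordE k : (modord k)%:Z = (k %% d%:Z)%Z.
Proof. by have := modz_ge0 k (d := d%:Z); rewrite /=; lia. Qed.

Lemma modord_id (i : 'I_d) : modord i = i.
Proof. by apply: val_inj => /=; rewrite modz_small //; have := ltn_ord i; lia. Qed.

Lemma modordP k (i : 'I_d) : (modord k == i) = (d%:Z %| k - i%:Z)%Z.
Proof.
rewrite -eqz_mod_dvd -(inj_eq val_inj) -eqz_nat modordE.
by rewrite (modz_small (m := i)) //; have := ltn_ord i; lia.
Qed.

Lemma dvdz_opp a b : (a %| - b)%Z = (a %| b)%Z.
Proof. by rewrite !dvdzE abszN. Qed.

(** Vectors on Z/d are treated as periodic functions of an integer, so that shifts become plain
    additions inside sums. *)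
Definition periodic f := forall k l, (d%:Z %| k - l)%Z -> f k = f l.

Lemma periodic_mod f k : periodic f -> f (modord k) = f k.
Proof. by move=> pf; apply/esym/pf; rewrite -modordP. Qed.

Lemma sum_periodic f c : periodic f ->
  \sum_(i < d) f (i%:Z + c) = \sum_(i < d) f i.
Proof.
move=> pf; rewrite [RHS](reindex_inj (h := fun i : 'I_d => modord (i%:Z + c))).
  by apply: eq_bigr => i _; rewrite periodic_mod.
move=> i j /eqP; rewrite modordP modordE => h; apply/eqP.
rewrite -[i]modord_id modordP.
have := h; rewrite -!eqz_mod_dvd modz_mod eqz_mod_dvd => {}h.
by rewrite eqz_mod_dvd; move: h; congr (_ %| _)%Z; ring.
Qed.

Lemma sum_periodic_delta f a : periodic f ->
  \sum_(i < d) f i * ((d%:Z %| a - i%:Z)%Z)%:R = f a.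
Proof.
move=> pf; rewrite (bigD1 (modord a)) // big1 => [|i ne].
  by rewrite -modordP eqxx mulr1 /= addr0 periodic_mod.
by rewrite -modordP eq_sym (negPf ne) mulr0.
Qed.

Lemma vatE x k : vat x k = x (modord k) 0.
Proof.
rewrite /vat /mxnat; case: insubP => [i _ Ei|]; last by rewrite modord_subproof.
case: insubP => [j _ Ej|] //; rewrite (ord1 j); congr (x _ _); exact: val_inj.
Qed.

Lemma vat_ord x (i : 'I_d) : vat x i = x i 0.
Proof. by rewrite vatE modord_id. Qed.

Lemma vat_periodic x : periodic (vat x).
Proof.
move=> k l kl; rewrite !vatE; congr (x _ _); apply/eqP.
by rewrite modordP modordE -eqz_mod_dvd modz_mod eqz_mod_dvd.
Qed.

Let z : C := zeta d.

Lemma zeta_neq0 : z != 0.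
Proof. by rewrite -normr_eq0 zeta_norm ?oner_eq0. Qed.

Lemma zeta_expz_eq1 k : (z ^ k == 1) = (d%:Z %| k)%Z.
Proof.
case: k => k.
  by rewrite -exprnP -(prim_order_dvd (zeta_prim C d0)) dvdzE.
rewrite NegzE -exprnN invr_eq1 -(prim_order_dvd (zeta_prim C d0)).
by rewrite dvdzE abszN.
Qed.

Lemma zeta_expz_periodic a : periodic (fun k => z ^ (a * k)).
Proof.
move=> k l kl; have z0 := zeta_neq0.
apply: (mulIf (x := z ^ (- (a * l)))); first by rewrite expfz_neq0.
rewrite -!expfzDr // subrr expr0z -mulrBr; apply/eqP.
by rewrite zeta_expz_eq1 dvdz_mull.
Qed.

Lemma norm_zeta_expz k : `|z ^ k| = 1.
Proof.
by case: k => k; rewrite ?NegzE -?exprnP -?exprnN ?normfV normrX zeta_norm // expr1n ?invr1.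
Qed.

Lemma conj_zeta_expz k : (z ^ k)^* = z ^ (- k).
Proof. by rewrite conjC_unit ?invr_expz // norm_zeta_expz. Qed.

Lemma dft_orthogonality a :
  \sum_(i < d) z ^ (a * i%:Z) = d%:R * ((d%:Z %| a)%Z)%:R.
Proof.
have powE (i : 'I_d) : z ^ (a * i%:Z) = (z ^ a) ^+ i by rewrite exprnP exprz_exp.
rewrite (eq_bigr _ (fun i _ => powE i)) -zeta_expz_eq1.
have [->|ne] := eqVneq.
  by rewrite (eq_bigr (fun _ => 1)) ?sumr_const ?card_ord ?mulr1 // => i _; rewrite expr1n.
rewrite mulr0; apply: (mulfI (x := z ^ a - 1)); first by rewrite subr_eq0.
rewrite -subrX1 mulr0; apply/eqP; rewrite subr_eq0 (exprnP (z ^ a) d) exprz_exp zeta_expz_eq1.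
exact: dvdz_mull.
Qed.

Lemma vat_dft x k : vat (dftmx d *m x) k = \sum_(i < d) x i 0 * z ^ (k * i%:Z).
Proof.
rewrite vatE mxE; apply: eq_bigr => i _; rewrite mxE mulrC; congr (_ * _).
rewrite exprnP PoszM modordE mulrC.
have := @zeta_expz_periodic i%:Z (k %% d)%Z k; rewrite mulrC (mulrC k) => -> //.
by rewrite -eqz_mod_dvd modz_mod.
Qed.

Lemma dft_inversion x k :
  d%:R * vat x k = \sum_(i < d) vat (dftmx d *m x) i * z ^ (- k * i%:Z).
Proof.
pose f j i : C := x j 0 * z ^ ((j%:Z - k) * i%:Z).
transitivity (\sum_(i < d) \sum_(j < d) f j i); last first.
  apply: eq_bigr => i _; rewrite vat_dft mulr_suml; apply: eq_bigr => j _.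
  by rewrite /f -mulrA -expfzDr ?zeta_neq0 //; congr (_ * _ ^ _); ring.
rewrite exchange_big /= -(sum_periodic_delta k (@vat_periodic x)) mulr_sumr.
apply: eq_bigr => j _; rewrite -mulr_sumr dft_orthogonality vat_ord.
by rewrite -[in RHS]dvdz_opp opprB; ring.
Qed.

(** The mask term is, up to a phase, a Fourier coefficient of the autocorrelation of m at lag w.
    Expanding both transforms of m, the sum over the frequency n forces s = t + w modulo d; the
    leftover factor z^(c(w-s)) then becomes z^(-ct). *)
Lemma gmask_corr m (c w : int) : z ^ (w * c) * gmask m c w =
  d%:R * \sum_(t < d) vat m t * (vat m (t%:Z + w))^* * z ^ (- c * t%:Z).
Proof.
have z0 := zeta_neq0.
pose f t s n : C := m t 0 * (m s 0)^* * z ^ (c * (w - s%:Z)) * z ^ ((w + t%:Z - s%:Z) * n%:Z).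
transitivity (\sum_(n < d) \sum_(t < d) \sum_(s < d) f t s n).
  rewrite /gmask vat_dft mulr_sumr; apply: eq_bigr => n _.
  rewrite [hadamard _ _ _ _]mxE [shiftv _ _ _ _]mxE -(vat_ord (dftmx d *m m)) vat_dft /conjv.
  have -> : vat (map_mx Num.conj (dftmx d *m m)) (n%:Z + c) =
            (vat (dftmx d *m m) (n%:Z + c))^* by rewrite !vatE mxE.
  rewrite vat_dft rmorph_sum /= -mulrA mulrCA mulr_suml; apply: eq_bigr => t _.
  rewrite mulrC mulr_suml mulr_sumr mulr_suml; apply: eq_bigr => s _.
  rewrite rmorphM /= conj_zeta_expz /f.
  rewrite (_ : c * (w - s%:Z) = w * c + (- c * s%:Z)); last by ring.
  rewrite (_ : (w + t%:Z - s%:Z) * n%:Z = w * n%:Z + n%:Z * t%:Z + (- (n%:Z * s%:Z)));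
    last by ring.
  rewrite (_ : - ((n%:Z + c) * s%:Z) = - c * s%:Z + (- (n%:Z * s%:Z))); last by ring.
  by rewrite !expfzDr //; ring.
rewrite exchange_big mulr_sumr; apply: eq_bigr => t _ /=.
pose g s : C := (vat m s)^* * z ^ (c * (w - s)).
have pg : periodic g.
  move=> k l kl; rewrite /g (vat_periodic m kl); congr (_ * _).
  apply: zeta_expz_periodic; rewrite -dvdz_opp; move: kl; congr (_ %| _)%Z; ring.
transitivity (d%:R * (m t 0 * g (t%:Z + w))); last first.
  rewrite /g vat_ord (_ : c * (w - (t%:Z + w)) = - c * t%:Z); first by ring.
  by ring.
rewrite -(sum_periodic_delta _ pg) exchange_big /= !mulr_sumr; apply: eq_bigr => s _.
rewrite -mulr_sumr dft_orthogonality /g vat_ord.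
by rewrite (addrC w t%:Z); ring.
Qed.

End Periodic.

(** * The aliased measurements *)

Lemma alphap_lt gamma L (al : int) : L = (2 * gamma).-1 -> (absz al < gamma)%N ->
  (alphap L al < L)%N.
Proof. by move=> -> h; rewrite /alphap; case: ifP; lia. Qed.

Lemma omegap_lt delta K (w : int) : K = (2 * delta).-1 -> (absz w < delta)%N ->
  (omegap K w < K)%N.
Proof. by move=> -> h; rewrite /omegap; case: ifP; lia. Qed.

Section Measurements.
Variables (C : numClosedFieldType) (d : nat).
Hypothesis d0 : (0 < d)%N.
Implicit Types (x m : 'cV[C]_d) (N : 'M[C]_d).

Let z : C := zeta d.

(** Two of the three factors d are spent on Fourier inversion of x at n and at n + w, the third on
    [gmask_corr], which evaluates the remaining sum over n. *)
Lemma sum_corr_dft x m (l w : int) :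
  d%:R ^+ 3 * (\sum_(n < d) vat x n * (vat x (n%:Z + w))^* *
    (vat m (n%:Z - l) * (vat m (n%:Z - l + w))^*)) =
  \sum_(p < d) \sum_(q < d) vat (dftmx d *m x) p * (vat (dftmx d *m x) q)^* *
    z ^ (w * p%:Z) * z ^ (l * (q%:Z - p%:Z)) * gmask m (p%:Z - q%:Z) w.
Proof.
have z0 : z != 0 by exact: zeta_neq0.
pose X k := vat (dftmx d *m x) k.
pose g t := vat m t * (vat m (t + w))^*.
have pg : periodic d g.
  move=> k k' h; rewrite /g (vat_periodic d0 m h); congr (_ * _^*).
  by apply: vat_periodic => //; move: h; congr (_ %| _)%Z; ring.
pose f (n p q : 'I_d) : C := d%:R * g (n%:Z - l) * (X p * z ^ (- n%:Z * p%:Z)) *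
  ((X q)^* * z ^ ((n%:Z + w) * q%:Z)).
transitivity (\sum_(p < d) \sum_(q < d) \sum_(n < d) f n p q); last first.
  apply: eq_bigr => p _; apply: eq_bigr => q _.
  have E : z ^ (w * p%:Z) * gmask m (p%:Z - q%:Z) w =
      z ^ (w * q%:Z) * (d%:R * \sum_(n < d) g (n%:Z - l) *
        z ^ (- (p%:Z - q%:Z) * (n%:Z - l))).
    (* Translation by l centres the autocorrelation of m at n - l, the position of the window. *)
    have := @sum_periodic C d d0 (fun t => g t * z ^ (- (p%:Z - q%:Z) * t)) (- l).
    move=> -> => [|k k' h]; last first.
      by rewrite (pg _ _ h); congr (_ * _); apply: zeta_expz_periodic h.
    rewrite -gmask_corr // mulrA -expfzDr //.
    by congr (z ^ _ * _); ring.
  transitivity (X p * (X q)^* * z ^ (l * (q%:Z - p%:Z)) *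
    (z ^ (w * p%:Z) * gmask m (p%:Z - q%:Z) w)); last by rewrite /X; ring.
  rewrite E !mulr_sumr.
  apply: eq_bigr => n _; rewrite /f.
  rewrite (_ : (n%:Z + w) * q%:Z = n%:Z * q%:Z + w * q%:Z); last by ring.
  rewrite (_ : - (p%:Z - q%:Z) * (n%:Z - l) = - n%:Z * p%:Z + n%:Z * q%:Z + - (l * (q%:Z - p%:Z)));
    last by ring.
  rewrite !expfzDr // /X.
  have : z ^ (- (l * (q%:Z - p%:Z))) * z ^ (l * (q%:Z - p%:Z)) = 1.
    by rewrite -expfzDr // addNr expr0z.
  move: (z ^ (- (l * (q%:Z - p%:Z)))) (z ^ (l * (q%:Z - p%:Z))) => u v uv.
  rewrite -[LHS]mulr1 -uv; ring.
under [RHS]eq_bigr => p _ do rewrite exchange_big /=.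
rewrite [RHS]exchange_big /= mulr_sumr; apply: eq_bigr => n _.
transitivity (d%:R * g (n%:Z - l) * (d%:R * vat x n) * (d%:R * vat x (n%:Z + w))^*).
  by rewrite rmorphM /= conjC_nat /g; ring.
rewrite !dft_inversion // rmorph_sum /= -!mulrA !mulr_suml !mulr_sumr.
apply: eq_bigr => p _; rewrite !mulr_sumr; apply: eq_bigr => q _.
by rewrite rmorphM /= conj_zeta_expz // /f /X !mulNr opprK /g /z; ring.
Qed.

Lemma dvdz_small (a b : int) : (a %| b)%Z -> (absz b < absz a)%N -> b = 0.
Proof.
rewrite dvdzE => ab lt; apply/eqP; rewrite -absz_eq0; apply: contraLR lt.
by rewrite -lt0n -leqNgt => b0; apply: dvdn_leq.
Qed.

Lemma dvdz_sub_modl (e a b c : int) : (e %| d%:Z)%Z ->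
  (e %| (a %% d%:Z)%Z - (b %% d%:Z)%Z + c)%Z = (e %| a - b + c)%Z.
Proof.
move=> ed; rewrite [in RHS](divz_eq a d) [in RHS](divz_eq b d).
rewrite [in RHS](_ : _ - (_ + _) + c = ((a %/ d)%Z - (b %/ d)%Z) * d%:Z +
  ((a %% d)%Z - (b %% d)%Z + c)); last by ring.
by rewrite [in RHS]rpredDl ?dvdz_mull.
Qed.

Variable (delta K : nat).
Hypothesis Kdvd : (K %| d)%N.
Hypothesis KE : K = (2 * delta).-1.

Let K0 : (0 < K)%N. Proof. exact: dvdn_gt0 Kdvd. Qed.

Lemma expz_zeta_div n (k : int) : (n %| d)%N -> zeta n ^ k = z ^ ((d %/ n)%:Z * k) :> C.
Proof. by move=> nd; rewrite -(zeta_exp_div C d0 nd) exprnP exprz_exp. Qed.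

Lemma vat_support m (t : int) : (forall n : 'I_d, (delta <= n)%N -> m n 0 = 0) ->
  vat m t != 0 -> (t %% d%:Z < delta%:Z)%Z.
Proof.
move=> mn; rewrite vatE // -(modordE d0); apply: contraNT.
by rewrite -leNgt => le; apply/eqP/mn.
Qed.

(** Removal of aliasing in frequency. Summing over K samples only yields the congruence of p with n
    + w modulo K, but the support of m upgrades it to a congruence modulo d. *)
Lemma sum_dft_measurements x m (l w : int) :
  (forall n : 'I_d, (delta <= n)%N -> m n 0 = 0) -> (absz w < delta)%N ->
  \sum_(k < K) `| \sum_(n < d) vat x n * vat m (n%:Z - l) *
     z ^+ (n * (k * (d %/ K))) | ^+ 2 * zeta K ^ (w * k%:Z) =
  K%:R * \sum_(n < d) vat x n * (vat x (n%:Z + w))^* *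
    (vat m (n%:Z - l) * (vat m (n%:Z - l + w))^*).
Proof.
move=> supp wd.
have zK0 : zeta K != 0 :> C by exact: zeta_neq0.
pose y t := vat x t * vat m (t - l).
pose f (n p : 'I_d) (k : 'I_K) : C := y n * (y p)^* * zeta K ^ ((n%:Z - p%:Z + w) * k%:Z).
transitivity (\sum_(n < d) \sum_(p < d) \sum_(k < K) f n p k).
  under [RHS]eq_bigr => n _ do rewrite exchange_big /=.
  rewrite [RHS]exchange_big /=; apply: eq_bigr => k _.
  have zE (n : 'I_d) : z ^+ (n * (k * (d %/ K))) = zeta K ^ (n%:Z * k%:Z) :> C.
    rewrite expz_zeta_div // exprnP; congr (_ ^ _); rewrite !PoszM; ring.
  rewrite normCK rmorph_sum /= mulr_suml mulr_suml; apply: eq_bigr => n _.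
  rewrite mulr_sumr mulr_suml; apply: eq_bigr => p _.
  rewrite !zE rmorphM /= conj_zeta_expz // /f.
  rewrite (_ : (n%:Z - p%:Z + w) * k%:Z = n%:Z * k%:Z + - (p%:Z * k%:Z) + w * k%:Z);
    last by ring.
  by rewrite !expfzDr // /y; ring.
rewrite mulr_sumr; apply: eq_bigr => n _.
pose h t := (y t)^*.
have ph : periodic d h.
  move=> k k' e; rewrite /h /y (vat_periodic d0 x e); congr (_ * _)^*.
  by apply: vat_periodic => //; move: e; congr (_ %| _)%Z; ring.
transitivity (K%:R * (y n * h (n%:Z + w))); last first.
  by rewrite /h /y rmorphM (addrAC n%:Z w); ring.
rewrite -(sum_periodic_delta d0 _ ph) !mulr_sumr; apply: eq_bigr => p _.
rewrite -mulr_sumr dft_orthogonality // (addrAC n%:Z w).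
have [->|yn] := eqVneq (y n) 0; first by rewrite !(mul0r, mulr0).
have [yp|yp] := eqVneq (y p) 0; first by rewrite /h yp rmorph0 !(mul0r, mulr0).
(* Nonzero [y n] and [y p] place n - l and p - l, reduced modulo d, in [0, delta). Together with |w|
   < delta this bounds the combination by 2 delta - 2 < K, so divisibility by K makes it vanish. *)
suff -> : (K%:Z %| n%:Z - p%:Z + w)%Z = (d%:Z %| n%:Z - p%:Z + w)%Z by rewrite /h; ring.
have KdZ : (K%:Z %| d%:Z)%Z by rewrite dvdzE.
apply/idP/idP => [Kn|]; last exact: dvdz_trans.
have yE t : y t != 0 -> (0 <= ((t - l) %% d%:Z)%Z < delta%:Z).
  rewrite mulf_eq0 negb_or => /andP[_ /(vat_support supp) ->].
  by rewrite modz_ge0 // eqz_nat; lia.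
have Dw (e : int) : (e %| n%:Z - p%:Z + w)%Z = (e %| (n%:Z - l) - (p%:Z - l) + w)%Z.
  by congr (_ %| _)%Z; ring.
move: Kn; rewrite (Dw K%:Z) (Dw d%:Z) -(dvdz_sub_modl _ _ _ KdZ)
  -(dvdz_sub_modl _ _ _ (dvdzz _)).
move=> /dvdz_small ->; first exact: dvdz0.
by have := yE _ yn; have := yE _ yp; lia.
Qed.

Lemma mxnat_ord p q (A : 'M[C]_(p, q)) (i : 'I_p) (j : 'I_q) : mxnat A i j = A i j.
Proof. by rewrite /mxnat !valK. Qed.

Lemma mxnat0 p q i j : mxnat (0 : 'M[C]_(p, q)) i j = 0.
Proof. by rewrite /mxnat; do 2 case: insub => // ?; rewrite mxE. Qed.

Variable (gamma L : nat).
Hypothesis Ldvd : (L %| d)%N.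
Hypothesis LE : L = (2 * gamma).-1.

Let L0 : (0 < L)%N. Proof. exact: dvdn_gt0 Ldvd. Qed.

Lemma zeta_alphap (al k : int) : (absz al < gamma)%N ->
  zeta L ^ ((alphap L al)%:Z * k) = zeta L ^ (- al * k) :> C.
Proof.
move=> h; rewrite mulrC (mulrC (- al)); apply: zeta_expz_periodic => //.
rewrite /alphap; case: ifP => al0.
  by rewrite (_ : _ - _ = 0) ?dvdz0 //; lia.
by rewrite (_ : _ - _ = L%:Z) ?dvdzz //; lia.
Qed.

Lemma zeta_omegap (w k : int) : (absz w < delta)%N ->
  zeta K ^ ((omegap K w)%:Z * k) = zeta K ^ (w * k) :> C.
Proof.
move=> h; rewrite mulrC (mulrC w); apply: zeta_expz_periodic => //.
rewrite /omegap; case: ifP => w0.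
  by rewrite (_ : _ - _ = 0) ?dvdz0 //; lia.
by rewrite (_ : _ - _ = K%:Z) ?dvdzz //; lia.
Qed.

Lemma Ytilde_noise x m N : Ytilde K L x m N =
  Ytilde K L x m 0 + dftmx L *m (Nsub K L N)^T *m (dftmx K)^T.
Proof.
rewrite /Ytilde -mulmxDl -mulmxDr -linearD /=; congr (_ *m _^T *m _).
apply/matrixP => k l; rewrite !mxE /Ymeas -addrA; congr (_ + _).
by rewrite mxnat0 add0r.
Qed.

(** The sum over k is treated by [sum_dft_measurements] and the result moved to the Fourier side by
    [sum_corr_dft]. The sum over l then selects q - p congruent to al modulo L, and the mask term
    becomes the common factor at -al. *)
Lemma Ytilde_entry x m (al w : int) :
  (forall k : 'I_d, (gamma <= k)%N -> (dftmx d *m x) k 0 = 0) ->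
  (forall n : 'I_d, (delta <= n)%N -> m n 0 = 0) ->
  (absz al < gamma)%N -> (absz w < delta)%N ->
  d%:R ^+ 3 * mxnat (Ytilde K L x m 0) (alphap L al) (omegap K w) =
  (K * L)%:R * (gmask m (- al) w * \sum_(p < d) \sum_(q < d | q%:Z - p%:Z == al)
    (dftmx d *m x) p 0 * ((dftmx d *m x) q 0)^* * z ^ (w * p%:Z)).
Proof.
move=> xs ms hal hw.
rewrite -[alphap L al]/(nat_of_ord (Ordinal (alphap_lt LE hal))).
rewrite -[omegap K w]/(nat_of_ord (Ordinal (omegap_lt KE hw))) mxnat_ord.
set X := dftmx d *m x.
pose F (p q : 'I_d) : C := X p 0 * (X q 0)^* * z ^ (w * p%:Z) * gmask m (p%:Z - q%:Z) w.
transitivity (d%:R ^+ 3 * \sum_(l < L) zeta L ^ (- al * l%:Z) *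
  (\sum_(k < K) `| \sum_(n < d) vat x n * vat m (n%:Z - (l * (d %/ L))%:Z) *
     z ^+ (n * (k * (d %/ K))) | ^+ 2 * zeta K ^ (w * k%:Z))).
  congr (_ * _); rewrite mxE; under eq_bigr => k _ do rewrite mxE mulr_suml.
  rewrite exchange_big /=; apply: eq_bigr => l _; rewrite mulr_sumr.
  apply: eq_bigr => k _; rewrite !mxE /= /Ymeas.
  rewrite mxnat0 addr0 -zeta_alphap // -zeta_omegap //.
  by rewrite -mulrA !exprnP !PoszM.
under eq_bigr => l _ do rewrite sum_dft_measurements // mulrCA.
rewrite -mulr_sumr natrM mulrCA -mulrA; congr (_ * _).
rewrite mulr_sumr; under eq_bigr => l _ do rewrite mulrCA sum_corr_dft.
pose G (l : 'I_L) p q := F p q * zeta L ^ ((q%:Z - p%:Z - al) * l%:Z).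
transitivity (\sum_(p < d) \sum_(q < d) \sum_(l < L) G l p q).
  under [RHS]eq_bigr => n _ do rewrite exchange_big /=.
  rewrite [RHS]exchange_big /=; apply: eq_bigr => l _.
  rewrite mulr_sumr; apply: eq_bigr => p _; rewrite mulr_sumr; apply: eq_bigr => q _.
  rewrite /G mulrBl expfzDr ?zeta_neq0 // mulNr (expz_zeta_div (_ * _) Ldvd) /F !vat_ord //.
  rewrite (_ : (l * (d %/ L))%:Z * (q%:Z - p%:Z) = (d %/ L)%:Z * ((q%:Z - p%:Z) * l%:Z));
    last by rewrite PoszM; ring.
  by ring.
rewrite !mulr_sumr; apply: eq_bigr => p _.
rewrite [in RHS]big_mkcond !mulr_sumr /=; apply: eq_bigr => q _.
rewrite /G -mulr_sumr dft_orthogonality // /F.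
have [gp|/xs Xp] := ltnP p gamma; last first.
  by rewrite /X Xp; case: ifP => _; rewrite !(mul0r, mulr0).
have [gq|/xs Xq] := ltnP q gamma; last first.
  by rewrite /X Xq rmorph0; case: ifP => _; rewrite !(mul0r, mulr0).
(* Removal of aliasing in the shift: p, q and |al| are below gamma, so the difference is at most 2
   gamma - 2 < L in modulus. *)
have -> : (L%:Z %| q%:Z - p%:Z - al)%Z = (q%:Z - p%:Z == al).
  apply/idP/eqP => [h|->]; last by rewrite subrr dvdz0.
  by have := dvdz_small h; lia.
case: eqP => [<-|_]; last by rewrite !mulr0.
by rewrite opprB mulr1; ring.
Qed.

End Measurements.

(** * Frobenius norm and Hermitian matrices *)

Section Frobenius.
Variable C : numClosedFieldType.

(** Working with the square of [frob], which on columns is also the square of [vnorm], keeps square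
    roots out of the estimates. *)
Definition sqfrob {m n} (A : 'M[C]_(m, n)) : C := \sum_i \sum_j `|A i j| ^+ 2.

Lemma sqfrob_ge0 m n (A : 'M[C]_(m, n)) : 0 <= sqfrob A.
Proof. by apply: sumr_ge0 => i _; apply: sumr_ge0 => j _; rewrite exprn_ge0. Qed.

Lemma sqfrob_eq0 m n (A : 'M[C]_(m, n)) : (sqfrob A == 0) = (A == 0).
Proof.
apply/eqP/eqP => [A0|->]; last first.
  by apply: big1 => i _; apply: big1 => j _; rewrite mxE normr0 expr0n.
apply/matrixP => i j; rewrite mxE; apply/eqP.
have row0 k : \sum_j `|A k j| ^+ 2 = 0.
  by apply: (psumr_eq0P _ A0) => // k' _; apply: sumr_ge0 => l _; rewrite exprn_ge0.
rewrite -normr_eq0 -sqrf_eq0; apply/eqP.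
by apply: (psumr_eq0P _ (row0 i)) => // l _; rewrite exprn_ge0.
Qed.

Lemma sqfrob0 m n : sqfrob (0 : 'M[C]_(m, n)) = 0.
Proof. by apply/eqP; rewrite sqfrob_eq0. Qed.

Lemma frobK m n (A : 'M[C]_(m, n)) : frob A ^+ 2 = sqfrob A.
Proof. exact: sqrtCK. Qed.

Lemma frob_ge0 m n (A : 'M[C]_(m, n)) : 0 <= frob A.
Proof. by rewrite sqrtC_ge0 sqfrob_ge0. Qed.

Lemma vnormK n (x : 'cV[C]_n) : vnorm x ^+ 2 = sqfrob x.
Proof. by rewrite sqrtCK; apply: eq_bigr => i _; rewrite big_ord1. Qed.

Lemma vnorm_ge0 n (x : 'cV[C]_n) : 0 <= vnorm x.
Proof. by rewrite sqrtC_ge0; apply: sumr_ge0 => i _; rewrite exprn_ge0. Qed.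

Lemma ctrK m n (A : 'M[C]_(m, n)) : ctr (ctr A) = A.
Proof. by apply/matrixP => i j; rewrite !mxE conjCK. Qed.

Lemma ctr_mul m n p (A : 'M[C]_(m, n)) (B : 'M[C]_(n, p)) :
  ctr (A *m B) = ctr B *m ctr A.
Proof. by rewrite /ctr map_mxM trmx_mul. Qed.

Lemma ctrD m n (A B : 'M[C]_(m, n)) : ctr (A + B) = ctr A + ctr B.
Proof. by rewrite /ctr map_mxD linearD. Qed.

Lemma ctrB m n (A B : 'M[C]_(m, n)) : ctr (A - B) = ctr A - ctr B.
Proof. by rewrite /ctr map_mxB linearB. Qed.

Lemma ctrZ m n a (A : 'M[C]_(m, n)) : ctr (a *: A) = a^* *: ctr A.
Proof. by rewrite /ctr map_mxZ linearZ. Qed.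

Lemma ctr_ct m n (A : 'M[C]_(m, n)) : ctr A = map_mx Num.conj A^T.
Proof. by rewrite /ctr map_trmx. Qed.

Lemma mxtrace_ctr n (A : 'M[C]_n) : \tr (ctr A) = (\tr A)^*.
Proof. by rewrite /mxtrace rmorph_sum; apply: eq_bigr => i _; rewrite !mxE. Qed.

Lemma sqfrobE m n (A : 'M[C]_(m, n)) : sqfrob A = \tr (ctr A *m A).
Proof.
rewrite /sqfrob exchange_big; apply: eq_bigr => j _; rewrite mxE.
by apply: eq_bigr => i _; rewrite !mxE normCKC.
Qed.

Lemma sqfrob_tr m n (A : 'M[C]_(m, n)) : sqfrob A^T = sqfrob A.
Proof.
by rewrite /sqfrob exchange_big; do 2 (apply: eq_bigr => ? _); rewrite mxE.
Qed.

Lemma sqfrob_ctr m n (A : 'M[C]_(m, n)) : sqfrob (ctr A) = sqfrob A.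
Proof. by rewrite !sqfrobE ctrK mxtrace_mulC. Qed.

Lemma sqfrobZ m n a (A : 'M[C]_(m, n)) : sqfrob (a *: A) = `|a| ^+ 2 * sqfrob A.
Proof.
rewrite /sqfrob mulr_sumr; apply: eq_bigr => i _; rewrite mulr_sumr.
by apply: eq_bigr => j _; rewrite mxE normrM exprMn.
Qed.

Lemma sqfrobD_orth m n (A B : 'M[C]_(m, n)) : ctr A *m B = 0 ->
  sqfrob (A + B) = sqfrob A + sqfrob B.
Proof.
move=> AB; have BA : ctr B *m A = 0.
  by rewrite -[LHS]ctrK ctr_mul ctrK AB /ctr map_mx0 trmx0.
by rewrite !sqfrobE ctrD mulmxDl !mulmxDr AB BA addr0 add0r mxtraceD.
Qed.

Lemma sqfrob_mul_isometry m n p (U : 'M[C]_(m, n)) (A : 'M[C]_(n, p)) c :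
  ctr U *m U = c%:M -> sqfrob (U *m A) = c * sqfrob A.
Proof.
move=> UU; rewrite !sqfrobE ctr_mul -mulmxA (mulmxA (ctr U)) UU.
by rewrite mul_scalar_mx -scalemxAr mxtraceZ.
Qed.

Lemma ctr_mul_self_col n (b : 'cV[C]_n) : ctr b *m b = (sqfrob b)%:M.
Proof. by rewrite [LHS]mx11_scalar sqfrobE /mxtrace big_ord1. Qed.

Lemma sqfrob_mul_col m n (A : 'M[C]_(m, n)) (b : 'cV[C]_n) :
  sqfrob (A *m b) <= sqfrob A * sqfrob b.
Proof.
have [->|bn0] := eqVneq b 0.
  by rewrite mulmx0 !sqfrob0 mulr0.
set r := sqfrob b.
have r0 : 0 < r by rewrite lt_def sqfrob_eq0 bn0 sqfrob_ge0.
have rc : r^* = r by rewrite geC0_conj // ltW.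
(* Cauchy-Schwarz, read off from |r A - X|^2 >= 0. *)
pose X := A *m b *m ctr b.
have XA : \tr (ctr X *m A) = sqfrob (A *m b).
  by rewrite ctr_mul ctrK -mulmxA mxtrace_mulC sqfrobE mulmxA.
have XX : sqfrob X = r * sqfrob (A *m b).
  rewrite -sqfrob_ctr ctr_mul ctrK -(sqfrob_ctr (A *m b)).
  exact/sqfrob_mul_isometry/ctr_mul_self_col.
have AX : \tr (ctr A *m X) = sqfrob (A *m b).
  rewrite -[ctr A *m X]ctrK mxtrace_ctr ctr_mul ctrK XA geC0_conj //.
  exact: sqfrob_ge0.
have := sqfrob_ge0 (r *: A - X).
rewrite sqfrobE ctrB ctrZ rc mulmxBl !mulmxBr -!scalemxAl -!scalemxAr scalerA.
rewrite !linearB /= !mxtraceZ XA AX -!sqfrobE XX.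
rewrite (_ : _ - _ = r * (sqfrob A * r - sqfrob (A *m b))); last by ring.
by rewrite pmulr_rge0 // subr_ge0.
Qed.

(** Parallelogram law for A and its adjoint, which have the same norm. *)
Lemma sqfrob_hermitian_part n (A : 'M[C]_n) :
  sqfrob (2%:R^-1 *: (A + ctr A)) <= sqfrob A.
Proof.
suff E : sqfrob (A + ctr A) + sqfrob (A - ctr A) = 4%:R * sqfrob A.
  have h4 : `|2%:R^-1 : C| ^+ 2 = 4%:R^-1.
    by rewrite normfV normr_nat exprVn -natrX.
  rewrite sqfrobZ h4 ler_pdivrMl ?ltr0n // -E lerDl; exact: sqfrob_ge0.
transitivity (2%:R * (sqfrob A + sqfrob (ctr A))); last by rewrite sqfrob_ctr; ring.
rewrite /sqfrob -!big_split mulr_sumr; apply: eq_bigr => i _ /=.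
rewrite -!big_split mulr_sumr; apply: eq_bigr => j _ /=.
by rewrite !(mxE _ _ _ _) !normCK !rmorphD rmorphN /= conjCK; ring.
Qed.

Lemma dft_isometry n : (0 < n)%N -> ctr (dftmx n) *m dftmx n = (n%:R : C)%:M.
Proof.
move=> n0; apply/matrixP => j k; rewrite !mxE.
transitivity (\sum_(i < n) (zeta n : C) ^ ((k%:Z - j%:Z) * i%:Z)).
  apply: eq_bigr => i _; rewrite !mxE !exprnP conj_zeta_expz // -expfzDr ?zeta_neq0 //.
  by congr (_ ^ _); rewrite !PoszM; ring.
rewrite dft_orthogonality // -modordP modord_id // eq_sym; case: eqP => _.
  by rewrite mulr1.
by rewrite mulr0.
Qed.

End Frobenius.

(** * Spectral theorem, Rayleigh quotients and the pseudo-inverse *)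

Section Spectral.
Variable C : numClosedFieldType.

(** [eigenvalue] refers to row vectors: the witness for the i-th diagonal entry is row i of P,
    nonzero because P is unitary. *)
Lemma hermitian_diagonalisation n (G : 'M[C]_n) : ctr G = G ->
  exists P (D : 'rV[C]_n), [/\ ctr P *m P = 1%:M, G = ctr P *m diag_mx D *m P &
    forall i, eigenvalue G (D 0 i)].
Proof.
move=> Gh.
have Gsym : G \is hermsymmx.
  by apply/is_hermitianmxP; rewrite expr0 scale1r -ctr_ct Gh.
have /orthomx_spectralP := hermitian_normalmx Gsym.
set P := spectralmx G; set D := spectral_diag G => GE.
have Pu : P \is unitarymx := spectral_unitarymx G.
have PP : P *m ctr P = 1%:M by rewrite ctr_ct; apply/unitarymxP.
have PiE : invmx P = ctr P by rewrite invmx_unitary // ctr_ct.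
exists P, D; split; first exact: mulmx1C.
  by rewrite {1}GE PiE.
move=> i; apply/eigenvalueP; exists (row i P).
  rewrite {1}GE PiE -row_mul !mulmxA PP mul1mx.
  by rewrite mul_diag_mx; apply/rowP => j; rewrite !mxE.
apply/eqP => Pi0; have /matrixP/(_ i i) := PP.
rewrite -[LHS]/((P *m ctr P) i i) -[P *m _]/(_) !mxE eqxx.
rewrite big1 => [/eqP|k _]; first by rewrite eq_sym oner_eq0.
by move/rowP/(_ k): Pi0; rewrite !mxE => ->; rewrite mul0r.
Qed.

(** The form is a sum of eigenvalues weighted by the squared norms of the rows of P Y, whose total
    is [sqfrob Y]. Allowing a matrix Y treats all its columns at once, as [pinv_bound] requires. *)
Lemma trace_hermitian_form n p (P : 'M[C]_n) (D : 'rV[C]_n) (Y : 'M[C]_(n, p)) :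
  \tr (ctr Y *m (ctr P *m diag_mx D *m P) *m Y) =
  \sum_i D 0 i * \sum_j `|(P *m Y) i j| ^+ 2.
Proof.
rewrite -!mulmxA (mulmxA (ctr Y)) -ctr_mul; move: (P *m Y) => Z.
rewrite /mxtrace; under [RHS]eq_bigr => i _ do rewrite mulr_sumr.
rewrite [RHS]exchange_big; apply: eq_bigr => j _; rewrite mxE.
apply: eq_bigr => i _; rewrite mul_diag_mx !mxE normCK; ring.
Qed.

Lemma rayleigh_le n p (G : 'M[C]_n) lam (Y : 'M[C]_(n, p)) : ctr G = G ->
  (forall mu, eigenvalue G mu -> mu <= lam) ->
  \tr (ctr Y *m G *m Y) <= lam * sqfrob Y.
Proof.
move=> /hermitian_diagonalisation [P [D [PP GE De]]] le.
rewrite GE trace_hermitian_form -[sqfrob Y]mul1r -(sqfrob_mul_isometry _ PP).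
rewrite mulr_sumr; apply: ler_sum => i _; apply: ler_wpM2r; last exact: le.
by apply: sumr_ge0 => j _; rewrite exprn_ge0.
Qed.

Lemma rayleigh_ge n p (G : 'M[C]_n) lam (Y : 'M[C]_(n, p)) : ctr G = G ->
  (forall mu, eigenvalue G mu -> lam <= mu) ->
  lam * sqfrob Y <= \tr (ctr Y *m G *m Y).
Proof.
move=> /hermitian_diagonalisation [P [D [PP GE De]]] le.
rewrite GE trace_hermitian_form -[sqfrob Y]mul1r -(sqfrob_mul_isometry _ PP).
rewrite mulr_sumr; apply: ler_sum => i _; apply: ler_wpM2r; last exact: le.
by apply: sumr_ge0 => j _; rewrite exprn_ge0.
Qed.

(** W Y is the orthogonal projection of X onto the range of W, so it is no longer than X, while the
    Rayleigh bound for the Gram matrix gives |W Y|^2 >= s^2 |Y|^2. *)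
Lemma pinv_bound m n p (W : 'M[C]_(m, n)) s (X : 'M[C]_(m, p)) :
  ctr W *m W \in unitmx -> smallest_sv W s ->
  s ^+ 2 * sqfrob (pinv W *m X) <= sqfrob X.
Proof.
move=> Wu [s0 [_ smin]]; set Y := pinv W *m X.
have HY : ctr W *m W *m Y = ctr W *m X.
  by rewrite /Y /pinv !mulmxA mulmxV // mul1mx.
have orth : ctr (W *m Y) *m (X - W *m Y) = 0.
  by rewrite ctr_mul -mulmxA mulmxBr mulmxA HY subrr mulmx0.
have := sqfrobD_orth orth; rewrite addrC subrK => ->.
apply: le_trans (_ : _ <= sqfrob (W *m Y)) _; last by rewrite lerDl sqfrob_ge0.
rewrite [leRHS]sqfrobE ctr_mul -mulmxA (mulmxA (ctr W)) mulmxA.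
by apply: rayleigh_ge; rewrite ?ctr_mul ?ctrK.
Qed.

Lemma gram_unitmx m n (W : 'M[C]_(m, n)) :
  (forall y : 'cV[C]_n, W *m y = 0 -> y = 0) -> ctr W *m W \in unitmx.
Proof.
move=> inj; rewrite -row_free_unit; apply: inj_row_free => v vH.
suff v0 : ctr v = 0 by rewrite -(ctrK v) v0 /ctr map_mx0 trmx0.
apply/inj/eqP; rewrite -sqfrob_eq0 sqfrobE ctr_mul ctrK -mulmxA (mulmxA (ctr W)).
by rewrite mulmxA vH mul0mx mxtrace0.
Qed.

Lemma smallest_sv_gt0 m n (W : 'M[C]_(m, n)) s :
  ctr W *m W \in unitmx -> smallest_sv W s -> 0 < s.
Proof.
move=> Wu [s0 [/eigenvalueP [v vH vn0] _]]; rewrite lt_def s0 andbT.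
apply: contraNneq vn0 => sE; rewrite -[v](mulmxK Wu) vH sE expr0n scale0r.
by rewrite mul0mx.
Qed.

End Spectral.

(** * The leading eigenvector near a rank-one matrix *)

Section Perturbation.
Variable C : numClosedFieldType.

(** Here r is the squared length of u, a the modulus of its component along v, and t the scaling of
    v. Thus r - a^2 + (a - t)^2 is the squared distance from u to the aligned multiple of v, and the
    residual hypothesis is |E v|^2 <= eta^2. *)
Lemma top_eigenvector_scalar_bound (r eta lam a t : C) :
  0 < r -> 0 <= eta -> 0 <= a -> 0 <= t -> t ^+ 2 = `|lam| -> lam \is Num.real ->
  a ^+ 2 <= r -> (lam - a ^+ 2) ^+ 2 + a ^+ 2 * (r - a ^+ 2) <= eta ^+ 2 ->
  r - eta <= lam -> r * (r - a ^+ 2 + (a - t) ^+ 2) <= 14%:R * eta ^+ 2.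
Proof.
move=> r0 eta0 a0 t0 tE lamR ar res laml.
have rR := gtr0_real r0; have etaR := ger0_real eta0.
have aR := ger0_real a0; have tR := ger0_real t0.
have DR : lam - a ^+ 2 \is Num.real by rewrite rpredB // rpredX.
have /andP[Dl Du] : - eta <= lam - a ^+ 2 <= eta.
  rewrite -real_ler_norml // -(@ler_pXn2r _ 2) ?nnegrE // real_normK //.
  by apply: le_trans res; rewrite lerDl mulr_ge0 ?exprn_ge0 ?subr_ge0.
(* Split at eta = 9 r / 20: for larger eta the crude bounds t^2 <= r + eta and
   (a - t)^2 <= a^2 + t^2 suffice, for smaller eta one has r <= 10 a^2. *)
have /orP[big|small] : (9%:R * r <= 20%:R * eta) || (20%:R * eta <= 9%:R * r).
  by apply: real_leVge; rewrite rpredM ?realn.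
  have tr : t ^+ 2 <= r + eta.
    rewrite tE real_ler_norml //; apply/andP; split.
      apply: le_trans laml; rewrite opprD lerD2r.
      by apply: (@le_trans _ _ 0); rewrite ?oppr_le0 ltW.
    by rewrite -subr_ge0 [leRHS](_ : _ = (r - a ^+ 2) + (eta - (lam - a ^+ 2)));
      [rewrite addr_ge0 ?subr_ge0 | ring].
  apply: (@le_trans _ _ (r * (2%:R * r + eta))).
    rewrite ler_pM2l // -subr_ge0.
    rewrite [leRHS](_ : _ = (r + eta - t ^+ 2) + 2%:R * (a * t)); last by ring.
    by rewrite addr_ge0 ?subr_ge0 // !mulr_ge0.
  (* At eta = 9r/20 the difference 14 eta^2 - r (2r + eta) equals 77 r^2 / 200; scaling by 200
     clears the denominators, and the rest factors through 20 eta - 9r. *)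
  rewrite -subr_ge0 -(@pmulr_rge0 _ 200%:R) ?ltr0n //.
  rewrite [leRHS](_ : _ = (20%:R * eta - 9%:R * r) * (140%:R * eta + 53%:R * r) +
    77%:R * r ^+ 2); last by ring.
  by rewrite addr_ge0 // mulr_ge0 ?subr_ge0 ?addr_ge0 ?mulr_ge0 ?ler0n ?exprn_ge0 // ltW.
(* Indeed a^2 >= lam - eta >= r - 2 eta >= r - 9r/10. *)
have ra : r <= 10%:R * a ^+ 2.
  rewrite -subr_ge0 -(@pmulr_rge0 _ 2%:R) ?ltr0n //.
  rewrite [leRHS](_ : _ = 20%:R * (eta - (lam - a ^+ 2)) + 20%:R * (lam - (r - eta)) +
    2%:R * (9%:R * r - 20%:R * eta)); last by ring.
  by rewrite !addr_ge0 // mulr_ge0 ?ler0n ?subr_ge0.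
have lam0 : 0 <= lam.
  apply: le_trans laml; rewrite subr_ge0 -(@ler_pM2l _ 20%:R) ?ltr0n //.
  apply: le_trans small _; apply: ler_wpM2r; first exact: ltW.
  by rewrite ler_nat.
rewrite ger0_norm // in tE.
apply: (@le_trans _ _ (10%:R * eta ^+ 2)); last first.
  by rewrite ler_wpM2r ?exprn_ge0 // ler_nat.
apply: le_trans (_ : _ <= 10%:R * ((lam - a ^+ 2) ^+ 2 + a ^+ 2 * (r - a ^+ 2))) _; last first.
  by rewrite ler_pM2l ?ltr0n.
rewrite [leLHS]mulrDr [leLHS]addrC [leRHS]mulrDr -tE; apply: lerD; last first.
  by rewrite [leRHS]mulrA ler_wpM2r ?subr_ge0.
(* With t^2 = lam, the component of the residual along v factors, and (t + a)^2 >= a^2 >= r/10. *)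
rewrite (_ : (t ^+ 2 - a ^+ 2) ^+ 2 = (t + a) ^+ 2 * (a - t) ^+ 2); last by ring.
rewrite mulrA ler_wpM2r //; first by rewrite -realEsqr rpredB.
apply: le_trans ra _; rewrite ler_pM2l ?ltr0n // ler_pXn2r ?nnegrE ?addr_ge0 //.
by rewrite lerDr.
Qed.

(** Split u = w + c v with w orthogonal to v. Taking for z the phase of c turns the squared distance
    into |w|^2 + (|c| - t)^2, which the scalar bound controls. *)
Lemma rank1_perturbation n (G : 'M[C]_n) (u v : 'cV[C]_n) (lam eta : C) :
  ctr G = G -> u != 0 -> 0 <= eta -> sqfrob (G - u *m ctr u) <= eta ^+ 2 ->
  top_eigpair G lam v ->
  exists z, `|z| = 1 /\
    sqfrob u * sqfrob (u - z *: (sqrtC `|lam| *: v)) <= 14%:R * eta ^+ 2.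
Proof.
move=> Gh un0 eta0 Eeta [Gv [v1 top]].
set r := sqfrob u.
have r0 : 0 < r by rewrite lt_def sqfrob_eq0 un0 sqfrob_ge0.
have v1' : sqfrob v = 1 by rewrite -vnormK v1 expr1n.
have vv : ctr v *m v = 1%:M by rewrite ctr_mul_self_col v1'.
set E := G - u *m ctr u in Eeta.
pose c := (ctr v *m u) 0 0.
have vu : ctr v *m u = c%:M by rewrite /c -mx11_scalar.
have uv : ctr u *m v = (c^*)%:M.
  by rewrite -[LHS]ctrK ctr_mul ctrK vu; apply/matrixP => i j; rewrite !mxE !ord1 !mulr1n.
pose w := u - c *: v.
have vw : ctr v *m w = 0.
  by rewrite mulmxBr vu -scalemxAr vv scalemx1 subrr.
have combo b : sqfrob (w + b *: v) = sqfrob w + `|b| ^+ 2.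
  rewrite addrC sqfrobD_orth ?ctrZ -?scalemxAl ?vw ?scaler0 //.
  by rewrite sqfrobZ v1' mulr1 addrC.
have uE : u = w + c *: v by rewrite subrK.
have rE : r = sqfrob w + `|c| ^+ 2 by rewrite /r {1}uE combo.
have lamR : lam \is Num.real.
  have lamE : ctr v *m G *m v = lam%:M by rewrite -mulmxA Gv -scalemxAr vv scalemx1.
  rewrite CrealE; have := congr1 (@ctr C 1 1) lamE.
  rewrite !ctr_mul ctrK Gh mulmxA lamE => /matrixP/(_ 0 0).
  by rewrite !mxE !eqxx !mulr1n => <-.
have wE : sqfrob w = r - `|c| ^+ 2 by rewrite rE addrK.
have Ev : E *m v = (lam - `|c| ^+ 2) *: v + (- c^*) *: w.
  rewrite mulmxBl Gv -mulmxA uv mul_mx_scalar {1}uE scalerDr scalerA normCKC.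
  by rewrite scalerBl scaleNr opprD addrA addrAC.
have ENorm : sqfrob (E *m v) = (lam - `|c| ^+ 2) ^+ 2 + `|c| ^+ 2 * (r - `|c| ^+ 2).
  rewrite Ev sqfrobD_orth; last first.
    by rewrite ctrZ -scalemxAl -scalemxAr vw !scaler0.
  by rewrite !sqfrobZ v1' wE mulr1 normrN norm_conjC real_normK ?rpredB ?rpredX ?normr_real.
(* Test the Rayleigh quotient of G at u: it is r plus that of E, which is at least -eta by
   Cauchy-Schwarz. *)
have low : r - eta <= lam.
  rewrite -(ler_pM2r r0); apply: le_trans (rayleigh_le u Gh top).
  have uEu : \tr (ctr u *m G *m u) = \tr (ctr u *m (E *m u)) + r * r.
    rewrite mulmxBl mulmxBr !mulmxA ctr_mul_self_col mul_scalar_mx.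
    by rewrite -scalemxAl ctr_mul_self_col linearB /= mxtraceZ mxtrace_scalar subrK.
  rewrite uEu mulrBl addrC lerD2r.
  have trR : \tr (ctr u *m (E *m u)) \is Num.real.
    rewrite CrealE -mxtrace_ctr !ctr_mul ctrK -mulmxA.
    by rewrite /E ctrB Gh ctr_mul ctrK.
  suff : `|\tr (ctr u *m (E *m u))| <= eta * r by rewrite real_ler_norml // => /andP[].
  rewrite -(@ler_pXn2r _ 2) ?nnegrE ?mulr_ge0 ?sqfrob_ge0 //.
  have -> : `|\tr (ctr u *m (E *m u))| ^+ 2 = sqfrob (ctr u *m (E *m u)).
    by rewrite /sqfrob /mxtrace !big_ord1.
  apply: le_trans (sqfrob_mul_col _ _) _; rewrite sqfrob_ctr -/r.
  rewrite exprMn mulrC expr2 [leRHS]mulrA; apply: ler_wpM2r; first exact: ltW.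
  apply: le_trans (sqfrob_mul_col _ _) _; apply: ler_wpM2r; first exact: ltW.
  exact: Eeta.
(* When c = 0 every phase is equally good, and 1 is taken. *)
pose z := if c == 0 then 1 else c / `|c|; pose t := sqrtC `|lam|.
have cz : c = z * `|c|.
  by rewrite /z; case: eqP => [->|/eqP cn0]; rewrite ?normr0 ?mulr0 // divfK ?normr_eq0.
have z1 : `|z| = 1.
  rewrite /z; case: eqP => [|/eqP cn0]; first by rewrite normr1.
  by rewrite normf_div normr_id divff // normr_eq0.
have t0 : 0 <= t by rewrite sqrtC_ge0 normr_ge0.
exists z; split=> //.
have -> : u - z *: (t *: v) = w + (c - z * t) *: v.
  by rewrite {1}uE scalerBl addrA scalerA.
rewrite combo wE {2}cz -mulrBr normrM z1 mul1r real_normK ?rpredB ?ger0_real //.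
apply: (@top_eigenvector_scalar_bound _ _ lam) => //; first exact: sqrtCK.
  by rewrite rE lerDr sqfrob_ge0.
rewrite -ENorm; apply: le_trans (sqfrob_mul_col _ _) _; rewrite v1' mulr1.
exact: Eeta.
Qed.
End Perturbation.

(** * Recovery from noisy measurements *)

Section Recovery.
Variable C : numClosedFieldType.

Lemma mxnatD p q (A B : 'M[C]_(p, q)) i j :
  mxnat (A + B) i j = mxnat A i j + mxnat B i j.
Proof.
rewrite /mxnat; case: insubP => [i' _ _|_]; last by rewrite addr0.
by case: insubP => [j' _ _|_]; rewrite ?mxE ?addr0.
Qed.

Lemma mxnatE p q (A : 'M[C]_(p, q)) i j (ip : (i < p)%N) (jq : (j < q)%N) :
  mxnat A i j = A (Ordinal ip) (Ordinal jq).
Proof. exact: (mxnat_ord A (Ordinal ip) (Ordinal jq)). Qed.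

Lemma sum_inj_le (I J : finType) (h : I -> J) (f : J -> C) : injective h ->
  (forall j, 0 <= f j) -> \sum_i f (h i) <= \sum_j f j.
Proof.
move=> hi f0; have := big_imset f (in2W hi : {in predT &, injective h}).
move=> /= <-; rewrite [leRHS](bigID [in h @: predT]) /= lerDl.
exact: sumr_ge0.
Qed.

Lemma sum_ord_support d g (F : 'I_d -> C) (le : (g <= d)%N) :
  (forall i : 'I_d, (g <= i)%N -> F i = 0) ->
  \sum_(i < d) F i = \sum_(i < g) F (widen_ord le i).
Proof.
move=> F0; rewrite -(big_ord_narrow le) [RHS]big_mkcond; apply: eq_bigr => i _.
by case: ltnP => // /F0.
Qed.

Lemma dftmx_unit n : (0 < n)%N -> dftmx n \in @unitmx C n.
Proof.
move=> n0; have h : (n%:R^-1 *: ctr (dftmx n)) *m dftmx n = 1%:M :> 'M[C]_n.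
  by rewrite -scalemxAl dft_isometry // scale_scalar_mx mulVf // pnatr_eq0 -lt0n.
by have [] := mulmx1_unit h.
Qed.

(** Once the phases coming from the offset delta - 1 are absorbed into y, the first gamma rows of W
    form a Vandermonde matrix with nodes z^k, distinct for k < gamma <= d. *)
Lemma Wmx_inj d gamma delta K (y : 'cV[C]_gamma) : (0 < d)%N -> (gamma <= d)%N ->
  (gamma <= K)%N -> Wmx d gamma delta K *m y = 0 -> y = 0.
Proof.
move=> d0 gd gK Wy; pose z : C := zeta d; have z0 : z != 0 by exact: zeta_neq0.
pose a : 'rV[C]_gamma := \row_k z ^+ k.
pose y' : 'cV[C]_gamma := \col_k (z ^ (- ((delta.-1)%:Z * k%:Z)) * y k 0).
have Vy : Vandermonde gamma a *m y' = 0.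
  apply/colP => j; have /colP/(_ (widen_ord gK j)) := Wy; rewrite !mxE => WyE.
  transitivity (\sum_k Wmx d gamma delta K (widen_ord gK j) k * y k 0); last exact: WyE.
  apply: eq_bigr => k _; rewrite !mxE mulrA; congr (_ * _).
  rewrite exprAC -exprM exprnP -expfzDr //; congr (_ ^ _); rewrite PoszM /=; ring.
have Vu : Vandermonde gamma a \in unitmx.
  rewrite unitmxE det_Vandermonde unitfE; apply/prodf_neq0 => i _.
  apply/prodf_neq0 => j ij; rewrite subr_eq0 !mxE.
  rewrite (eq_prim_root_expr (zeta_prim C d0)) !modn_small.
  - by rewrite gtn_eqF.
  - exact: leq_trans gd.
  - exact: leq_trans gd.
have y'0 : y' = 0 by rewrite -[y'](mulKmx Vu) Vy mulmx0.
apply/colP => k; have /colP/(_ k) := y'0; rewrite !mxE => /eqP.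
by rewrite mulf_eq0 expfz_eq0 (negPf z0) andbF => /eqP.
Qed.

(** * The linear model for V and the propagation of the noise *)

Section Model.
Variables (d gamma delta K L : nat) (x m : 'cV[C]_d) (N : 'M[C]_d) (mu2 : C).
Hypotheses (d0 : (0 < d)%N) (gamma0 : (0 < gamma)%N) (delta0 : (0 < delta)%N).
Hypotheses (LE : L = (2 * gamma).-1) (KE : K = (2 * delta).-1).
Hypotheses (Kdvd : (K %| d)%N) (Ldvd : (L %| d)%N).
Hypotheses (gK : (gamma <= K)%N) (Kd : (K < d)%N).
Hypothesis xsupp : forall k : 'I_d, (gamma <= k)%N -> (dftmx d *m x) k 0 = 0.
Hypothesis msupp : forall n : 'I_d, (delta <= n)%N -> m n 0 = 0.
Hypotheses (mu2P : is_mu2 gamma delta m mu2) (mu20 : 0 < mu2).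

Let gd : (gamma <= d)%N. Proof. exact: leq_trans gK (ltnW Kd). Qed.
Let L0 : (0 < L)%N. Proof. exact: dvdn_gt0 Ldvd. Qed.
Let K0 : (0 < K)%N. Proof. exact: dvdn_gt0 Kdvd. Qed.

Let W := Wmx d gamma delta K : 'M[C]_(K, gamma).
Let u : 'cV[C]_gamma := \col_j (dftmx d *m x) (widen_ord gd j) 0.
Let om (j : 'I_K) : int := j%:Z - (delta.-1)%:Z.
Let al (a : 'I_L) : int := a%:Z - (gamma.-1)%:Z.
Let noise : 'M[C]_(L, K) := dftmx L *m (Nsub K L N)^T *m (dftmx K)^T.
Let coef : C := (d ^ 3)%:R / (K * L)%:R.

Let om_lt j : (absz (om j) < delta)%N.
Proof. by have := ltn_ord j; rewrite /om; lia. Qed.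

Let al_lt a : (absz (al a) < gamma)%N.
Proof. by have := ltn_ord a; rewrite /al; lia. Qed.

Let gmask_ge j a : mu2 <= `|gmask m (- al a) (om j)|.
Proof.
by apply: mu2P.1; [have := al_lt a | have := om_lt j]; rewrite ?abszN; lia.
Qed.

Let gmask_neq0 j a : gmask m (- al a) (om j) != 0.
Proof. by rewrite -normr_gt0; apply: lt_le_trans (gmask_ge j a). Qed.

(** Column a holds the diagonal q - p = a - (gamma - 1) of u u^*. The sum has at most one term and
    gives 0 when q falls outside [gamma]_0. *)
Let B0 : 'M[C]_(gamma, L) := \matrix_(p, a)
  \sum_(q < gamma | (q + gamma.-1)%N == (p + a)%N) u p 0 * (u q 0)^*.

Let E : 'M[C]_(K, L) := \matrix_(j, a)
  (coef * (mxnat noise (alphap L (al a)) (omegap K (om j)) / gmask m (- al a) (om j))).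

Lemma Vmx_decomp : Vmx gamma delta K L x m N = W *m B0 + E.
Proof.
apply/matrixP => j a; rewrite !mxE /= -/(om j) -/(al a).
rewrite Ytilde_noise mxnatD mulrDl mulrDr; congr (_ + _).
have KL0 : (K * L)%:R != 0 :> C by rewrite pnatr_eq0 -lt0n muln_gt0 K0.
have := Ytilde_entry d0 Kdvd KE Ldvd LE xsupp msupp (al_lt a) (om_lt j).
set S := \sum_(p < d) _; rewrite -natrX => YE.
transitivity S.
  rewrite -/(om j) -/(al a).
  apply: (mulfI KL0); apply: (mulfI (gmask_neq0 j a)).
  (* Division by the nonvanishing mask term undoes the factor supplied by [Ytilde_entry], and [coef]
     its normalisation. *)
  rewrite [RHS]mulrCA -YE; field.
  by rewrite gmask_neq0 // !pnatr_eq0 -!lt0n K0 L0.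
rewrite /S; etransitivity.
  apply: (sum_ord_support gd) => p /xsupp ->.
  by apply: big1 => q _; rewrite !mul0r.
apply: eq_bigr => p _; rewrite !mxE.
rewrite [in LHS]big_mkcond [in RHS]big_mkcond /=; etransitivity.
  apply: (sum_ord_support gd) => q /xsupp ->.
  by case: ifP; rewrite ?conjC0 ?mulr0 ?mul0r.
rewrite mulr_sumr.
apply: eq_bigr => q _.
have -> : ((q + gamma.-1)%N == (p + a)%N) =
    ((widen_ord gd q)%:Z - (widen_ord gd p)%:Z == al a).
  by rewrite /al /=; apply/eqP/eqP; lia.
by case: ifP => _; rewrite ?mulr0 // mulrC !mxE.
Qed.

Lemma sqfrob_noise : sqfrob noise = (K * L)%:R * sqfrob (Nsub K L N).
Proof.
rewrite /noise -mulmxA (sqfrob_mul_isometry _ (dft_isometry C L0)).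
rewrite -trmx_mul sqfrob_tr (sqfrob_mul_isometry _ (dft_isometry C K0)).
by rewrite natrM; ring.
Qed.

(** The maps alpha to alpha' and omega to omega' are injective from the index sets to themselves, so
    they only permute the entries. *)
Lemma sqfrob_noise_entries :
  \sum_j \sum_a `|mxnat noise (alphap L (al a)) (omegap K (om j))| ^+ 2 =
  sqfrob noise.
Proof.
pose hL a := Ordinal (alphap_lt LE (al_lt a)).
pose hK j := Ordinal (omegap_lt KE (om_lt j)).
have hLi : injective hL.
  move=> a b [] e; apply: val_inj; move: e; have := ltn_ord a; have := ltn_ord b.
  by rewrite /alphap /al /=; case: ifP; case: ifP; lia.
have hKi : injective hK.
  move=> a b [] e; apply: val_inj; move: e; have := ltn_ord a; have := ltn_ord b.
  by rewrite /omegap /om /=; case: ifP; case: ifP; lia.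
rewrite /sqfrob exchange_big [RHS](reindex_inj hLi); apply: eq_bigr => a _ /=.
rewrite [RHS](reindex_inj hKi); apply: eq_bigr => j _ /=.
by rewrite -mxnat_ord.
Qed.

Lemma sqfrob_E_le :
  sqfrob E <= (coef / mu2) ^+ 2 * ((K * L)%:R * sqfrob (Nsub K L N)).
Proof.
rewrite -sqfrob_noise -sqfrob_noise_entries mulr_sumr; apply: ler_sum => j _.
rewrite mulr_sumr; apply: ler_sum => a _; rewrite mxE.
have c0 : 0 <= coef by rewrite divr_ge0 ?ler0n.
move: (coef) c0 => k k0.
rewrite normrM (ger0_norm k0) normrM !exprMn -[leRHS]mulrA.
apply: ler_wpM2l; first exact: exprn_ge0.
rewrite mulrC; apply: ler_wpM2r; first exact: exprn_ge0.
have mi : 0 <= mu2^-1 by rewrite invr_ge0 ltW.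
rewrite ler_pXn2r ?nnegrE ?normr_ge0 // normfV.
by rewrite lef_pV2 ?posrE ?normr_gt0 // gmask_ge.
Qed.

Lemma gram_W_unit : ctr W *m W \in unitmx.
Proof. by apply: gram_unitmx => y; exact: Wmx_inj. Qed.

(** As [pinv W] is a left inverse of W, the noise-free part of G_0 is u u^*, already Hermitian. The
    rest is the Hermitian part of D, whose entries are picked from [pinv W *m E]. *)
Lemma Gmx_error s : smallest_sv W s ->
  sqfrob (Gmx gamma delta K L x m N - u *m ctr u) <= sqfrob E / s ^+ 2.
Proof.
move=> sv; have s0 := smallest_sv_gt0 gram_W_unit sv.
pose D : 'M[C]_gamma := \matrix_(j, k) mxnat (pinv W *m E) j (k + gamma.-1 - j)%N.
have idx (j k : 'I_gamma) : (k + gamma.-1 - j < L)%N.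
  by have := ltn_ord j; have := ltn_ord k; lia.
have GE : Gmx gamma delta K L x m N = u *m ctr u + 2%:R^-1 *: (D + ctr D).
  rewrite /Gmx Vmx_decomp -/W.
  have -> : pinv W *m (W *m B0 + E) = B0 + pinv W *m E.
    by rewrite mulmxDr /pinv -!mulmxA (mulmxA (ctr W) W) mulKmx ?gram_W_unit.
  set G0 := \matrix_(j, k) _.
  have -> : G0 = u *m ctr u + D.
    apply/matrixP => j k; rewrite [LHS]mxE [RHS]mxE [D j k]mxE mxnatD.
    congr (_ + _); rewrite (mxnatE _ (ltn_ord j) (idx j k)) [LHS]mxE.
    rewrite (bigD1 k) /=; last by apply/eqP; have := ltn_ord j; lia.
    rewrite big1 ?addr0 => [|q /andP[/eqP h /eqP ne]].
      by rewrite [RHS]mxE big_ord1 [ctr u _ _]mxE [map_mx _ _ _ _]mxE;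
          congr (u _ _ * _); apply: val_inj.
    by case: ne; apply: val_inj => /=; have := ltn_ord j; lia.
  rewrite ctrD ctr_mul ctrK addrACA scalerDr -mulr2n -scaler_nat scalerA.
  by rewrite mulVf ?scale1r // pnatr_eq0.
rewrite GE addrC addKr; apply: le_trans (sqfrob_hermitian_part _) _.
rewrite ler_pdivlMr ?exprn_gt0 // mulrC.
apply: le_trans _ (pinv_bound E gram_W_unit sv).
rewrite ler_pM2l ?exprn_gt0 //; apply: ler_sum => j _.
(* Row j of D uses pairwise distinct entries of row j of [pinv W *m E], so the selection cannot
   increase the norm. *)
have inj : injective (fun k => Ordinal (idx j k)).
  by move=> k k' [] e; apply: val_inj; move: e; rewrite /=; have := ltn_ord j; lia.
apply: le_trans _ (sum_inj_le inj (f := fun a => `|(pinv W *m E) j a| ^+ 2) _).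
  by apply: ler_sum => k _; rewrite mxE (mxnatE _ (ltn_ord j) (idx j k));
     rewrite (_ : Ordinal (ltn_ord j) = j) //; apply: val_inj.
by move=> a; rewrite exprn_ge0.
Qed.

Lemma Gmx_hermitian : ctr (Gmx gamma delta K L x m N) = Gmx gamma delta K L x m N.
Proof. by rewrite /Gmx ctrZ ctrD ctrK addrC fmorphV rmorph_nat. Qed.

Lemma sqfrob_restrict (A : 'cV[C]_d) (b : 'cV[C]_gamma) :
  (forall i : 'I_d, (gamma <= i)%N -> A i 0 = 0) ->
  (forall j, A (widen_ord gd j) 0 = b j 0) -> sqfrob A = sqfrob b.
Proof.
move=> A0 Ab; rewrite /sqfrob; etransitivity.
  apply: (sum_ord_support gd) => i gi; rewrite big_ord1 A0 // normr0 expr0n //.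
by apply: eq_bigr => j _; rewrite !big_ord1 Ab.
Qed.

Lemma recovery_bound (beta s lam1 : C) (v1 : 'cV[C]_gamma) :
  x != 0 -> 0 <= beta -> frob (Nsub K L N) <= beta * vnorm x ^+ 2 ->
  top_eigpair (Gmx gamma delta K L x m N) lam1 v1 ->
  smallest_sv (Wmx d gamma delta K) s ->
  exists z : C, `|z| = 1 /\
    vnorm (x - z *: (invmx (dftmx d) *m xhat_e d gamma lam1 v1)) / vnorm x
    <= (1 + 2 * sqrtC 2) * beta / s * ((d ^ 2)%:R / (sqrtC (K * L)%:R * mu2)).
Proof.
move=> xn0 beta0 Nle top sv; have s0 := smallest_sv_gt0 gram_W_unit sv.
have X0 : 0 < vnorm x.
  by rewrite lt_def vnorm_ge0 andbT -sqrf_eq0 vnormK sqfrob_eq0.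
have dR0 : 0 < d%:R :> C by rewrite ltr0n.
have KL0 : 0 < (K * L)%:R :> C by rewrite ltr0n muln_gt0 K0.
pose kap : C := sqrtC (K * L)%:R.
have kap0 : 0 < kap by rewrite sqrtC_gt0.
have kapE : (K * L)%:R = kap ^+ 2 by rewrite sqrtCK.
(* This is [coef / mu2], times sqrt(KL) from the two scaled isometries, times the noise bound, times
   1/s for the pseudo-inverse. *)
pose eta := d%:R ^+ 3 * beta * vnorm x ^+ 2 / (kap * mu2 * s).
have eta0 : 0 <= eta.
  by rewrite divr_ge0 ?mulr_ge0 ?exprn_ge0 // ltW // ?mulr_gt0.
have Gerr : sqfrob (Gmx gamma delta K L x m N - u *m ctr u) <= eta ^+ 2.
  apply: le_trans (Gmx_error sv) _; rewrite ler_pdivrMr ?exprn_gt0 //.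
  apply: le_trans sqfrob_E_le _.
  have -> : eta ^+ 2 * s ^+ 2 =
      (coef / mu2) ^+ 2 * ((K * L)%:R * (beta * vnorm x ^+ 2) ^+ 2).
    rewrite /eta /coef natrX kapE; field.
    by rewrite !gt_eqF.
  rewrite ler_wpM2l ?exprn_ge0 ?divr_ge0 ?ler0n ?(ltW mu20) // ler_pM2l //.
  by rewrite -frobK ler_pXn2r ?nnegrE ?frob_ge0 ?mulr_ge0 ?exprn_ge0 ?vnorm_ge0.
(* Parseval: the unnormalised transform multiplies squared norms by d. *)
have uE : sqfrob u = d%:R * vnorm x ^+ 2.
  rewrite vnormK -(sqfrob_mul_isometry _ (dft_isometry C d0)).
  by apply/esym/sqfrob_restrict => // j; rewrite [RHS]mxE.
have un0 : u != 0 by rewrite -sqfrob_eq0 uE gt_eqF // mulr_gt0 ?exprn_gt0.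
have [z [z1 err]] := rank1_perturbation Gmx_hermitian un0 eta0 Gerr top.
exists z; split=> //; set e := x - _.
have eE : sqfrob (u - z *: (sqrtC `|lam1| *: v1)) = d%:R * vnorm e ^+ 2.
  rewrite vnormK -(sqfrob_mul_isometry _ (dft_isometry C d0)).
  rewrite mulmxBr -scalemxAr (mulKVmx (dftmx_unit d0)).
  apply/esym/sqfrob_restrict => [i gi|j].
    by rewrite [LHS]mxE xsupp // !mxE ltnNge gi /= mulr0 subr0.
  rewrite [LHS]mxE [RHS]mxE [u j 0]mxE; congr (_ + _).
  by rewrite !mxE /= ltn_ord -[v1 j 0]mxnat_ord.
(* The square is 9 + 4 sqrt 2, and 4 sqrt 2 >= 5 because 32 >= 25. *)
have sqrt2 : 14%:R <= (1 + 2 * sqrtC 2) ^+ 2 :> C.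
  have q0 : 0 <= sqrtC 2 :> C by rewrite sqrtC_ge0 ler0n.
  have -> : (1 + 2 * sqrtC 2) ^+ 2 = 9%:R + 4%:R * sqrtC 2 :> C.
    transitivity (1 + 4%:R * sqrtC 2 + 4%:R * sqrtC 2 ^+ 2 : C); first by ring.
    by rewrite sqrtCK; ring.
  rewrite -lerBlDl -natrB // -(@ler_pXn2r _ 2) ?nnegrE ?ler0n ?mulr_ge0 //.
  by rewrite exprMn sqrtCK -!natrX -natrM ler_nat.
rewrite uE eE in err.
rewrite -(@ler_pXn2r _ 2) ?nnegrE; first last.
- have r0 : 0 <= 1 + 2 * sqrtC 2 :> C by rewrite addr_ge0 ?mulr_ge0 ?sqrtC_ge0 ?ler0n.
  rewrite mulr_ge0 // divr_ge0 ?mulr_ge0 ?ler0n ?(ltW s0) ?(ltW mu20) //.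
  exact: ltW kap0.
- by rewrite divr_ge0 ?vnorm_ge0.
- by [].
(* Multiplying the squared relative error by the square of [sqfrob u] produces the left side of
   [err]; one factor d of eta cancels, leaving d^2. *)
have dX : 0 < (d%:R * vnorm x ^+ 2) ^+ 2 by rewrite exprn_gt0 ?mulr_gt0 ?exprn_gt0.
rewrite -(ler_pM2l dX).
have -> : (d%:R * vnorm x ^+ 2) ^+ 2 * (vnorm e / vnorm x) ^+ 2 =
    d%:R * vnorm x ^+ 2 * (d%:R * vnorm e ^+ 2).
  by field; rewrite gt_eqF.
apply: le_trans err _; apply: le_trans (ler_wpM2r (exprn_ge0 2 eta0) sqrt2) _.
rewrite le_eqVlt; apply/orP; left; apply/eqP.
rewrite -/kap /eta natrX; field.
by rewrite !gt_eqF.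
Qed.

End Model.
End Recovery.

Unset Implicit Arguments.
Set Strict Implicit.

Theorem theorem2 (C : numClosedFieldType) (d gamma delta K L : nat)
  (x m : 'cV[C]_d) (N : 'M[C]_d) (beta mu2 s lam1 : C) (v1 : 'cV[C]_gamma) :
  (0 < d)%N ->
  x != 0 ->
  (forall k : 'I_d, (gamma <= k)%N -> (dftmx d *m x) k 0 = 0) ->
  (forall n : 'I_d, (delta <= n)%N -> m n 0 = 0) ->
  (gamma%:Z <= 2 * delta%:Z - 1)%R -> (2 * delta%:Z - 1 < d%:Z)%R ->
  L = (2 * gamma).-1 -> K = (2 * delta).-1 ->
  (K %| d)%N -> (L %| d)%N ->
  (forall i j, N i j \is Num.real) ->
  is_mu2 gamma delta m mu2 -> 0 < mu2 ->
  0 <= beta ->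
  frob (Nsub K L N) <= beta * vnorm x ^+ 2 ->
  top_eigpair (Gmx gamma delta K L x m N) lam1 v1 ->
  smallest_sv (Wmx d gamma delta K) s ->
  exists z : C, `|z| = 1 /\
    vnorm (x - z *: (invmx (dftmx d) *m xhat_e d gamma lam1 v1)) / vnorm x
    <= (1 + 2 * sqrtC 2) * beta / s * ((d ^ 2)%:R / (sqrtC (K * L)%:R * mu2)).
Proof.
move=> d0 xn0 xsupp msupp gK Kd LE KE Kdvd Ldvd _ mu2P mu20 beta0 Nle top sv.
(* If gamma were 0, the transform of x and hence x would vanish. Positivity makes the truncated
   predecessors defining L and K genuine subtractions. *)
have gamma0 : (0 < gamma)%N.
  rewrite lt0n; apply: contraNneq xn0 => g0; apply/eqP.
  rewrite -[x](mulKmx (dftmx_unit C d0)) (_ : dftmx d *m x = 0) ?mulmx0 //.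
  by apply/colP => k; rewrite xsupp ?g0 // mxE.
have delta0 : (0 < delta)%N by lia.
have gK' : (gamma <= K)%N by lia.
have Kd' : (K < d)%N by lia.
exact: (recovery_bound d0 gamma0 delta0 LE KE Kdvd Ldvd gK' Kd' xsupp msupp mu2P
  mu20 xn0 beta0 Nle top sv).
Qed.
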